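(* Suppose a net $\Lambda=\langle Q_1,Q_2,Q_3\rangle$ of quadrics in $\mathbb{P}^5$ defines a complete intersection surface $S$ whose discriminant $\Delta(S)$ is reduced. If $\Delta(S)$ is stable with respect to the natural $SL(3)$-action on plane sextics, then $\Lambda$ is stable with respect to the $SL(6)$-action.
   Context: A net of quadrics in $\mathbb{P}^5$ is a $3$-dimensional subspace $\Lambda$ of the space $W$ of quadratic forms in $6$ variables, viewed in $Gr(3,W)\subset\mathbb{P}(\bigwedge^3W)$ with natural $SL(6)$-action (GIT stability via Plücker embedding). If $A_i$ is the symmetric matrix of $Q_i$, the discriminant is the plane sextic $\Delta(S)=\{\det(xA_1+yA_2+zA_3)=0\}$; its stability refers to GIT stability of the ternary sextic form under $SL(3)$, and reduced means the sextic polynomial is square-free. *)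

(* Defs.v *)
From mathcomp Require Import all_boot all_algebra.
From mathcomp Require Import Rstruct.
From mathcomp Require Import complex.
From mathcomp Require Export mpoly.
Set Implicit Arguments.
Unset Strict Implicit.
Unset Printing Implicit Defensive.
Import GRing.Theory.
Local Open Scope ring_scope.

Definition CC : closedFieldType := complex Rdefinitions.R.

Section GIT.
Variable F : fieldType.

Definition vec (I : finType) := {ffun I -> F}.

Inductive polyfun (I : finType) : (vec I -> F) -> Prop :=
| pf_const (c : F) : polyfun (fun _ => c)
| pf_coord (i : I) : polyfun (fun v => v i)
| pf_add f g : polyfun f -> polyfun g -> polyfun (fun v => f v + g v)
| pf_mul f g : polyfun f -> polyfun g -> polyfun (fun v => f v * g v).

Definition zariski_closed (I : finType) (S : vec I -> Prop) : Prop :=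
  forall v, ~ S v ->
    exists f, [/\ polyfun f, (forall w, S w -> f w = 0) & f v <> 0].

Definition SL (n : nat) (g : 'M[F]_n) : Prop := \det g = 1.

(* GIT stability (Mumford) of the point [v] of P(F^I), v = orb 1, for a
   linear action of SL(n) on F^I given through the orbit map
   orb g = g . v :  v <> 0, the orbit SL(n).v is closed in F^I and the
   stabilizer of v in SL(n) is finite. *)
Definition git_stable (n : nat) (I : finType) (orb : 'M[F]_n -> vec I) : Prop :=
  [/\ orb 1%:M != 0,
      zariski_closed (fun w => exists2 g, SL g & w = orb g)
    & exists s : seq 'M[F]_n, forall g, SL g -> orb g = orb 1%:M -> g \in s].

Definition quadric (A : 'M[F]_6) : {mpoly F[6]} :=
  \sum_(i < 6) \sum_(j < 6) A i j *: ('X_i * 'X_j).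

(* Natural left action of g in SL(6) on quadratic forms:
   (g.Q)(x) = Q(g^-1 x), i.e. A |-> (g^-1)^T A g^-1. *)
Definition act_quad (g A : 'M[F]_6) : 'M[F]_6 :=
  (invmx g)^T *m A *m invmx g.

(* Coordinates of W (quadratic forms) through all matrix entries (a linear,
   SL(6)-equivariant embedding of W into 'M_6), and Plücker coordinates of
   Q1 /\ Q2 /\ Q3 : all 3x3 minors of the 3 x 36 coordinate matrix. *)
Definition windex := ('I_6 * 'I_6)%type.
Definition pl_index := (windex * windex * windex)%type.

Definition plucker (A1 A2 A3 : 'M[F]_6) : vec pl_index :=
  [ffun t : pl_index =>
     let pick (r : 'I_3) := if r == 0 :> nat then A1
                            else if r == 1 :> nat then A2 else A3 in
     let col (s : 'I_3) := if s == 0 :> nat then t.1.1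
                           else if s == 1 :> nat then t.1.2 else t.2 in
     \det (\matrix_(r < 3, s < 3) pick r (col s).1 (col s).2)].

Definition net_stable (A1 A2 A3 : 'M[F]_6) : Prop :=
  git_stable (fun g : 'M[F]_6 =>
    plucker (act_quad g A1) (act_quad g A2) (act_quad g A3)).

(* Q1, Q2, Q3 is a regular sequence in F[x0..x5], i.e. the net defines a
   complete intersection (a surface S in P^5). *)
Definition complete_intersection (Q1 Q2 Q3 : {mpoly F[6]}) : Prop :=
  [/\ Q1 != 0,
      (forall f h, Q2 * f = h * Q1 -> exists h', f = h' * Q1)
    & (forall f h1 h2, Q3 * f = h1 * Q1 + h2 * Q2 ->
         exists h1' h2', f = h1' * Q1 + h2' * Q2)].

Definition discriminant (A1 A2 A3 : 'M[F]_6) : {mpoly F[3]} :=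
  \det (\matrix_(i < 6, j < 6)
          ('X_0 * (A1 i j)%:MP + 'X_1 * (A2 i j)%:MP + 'X_2 * (A3 i j)%:MP)).

Definition reduced (f : {mpoly F[3]}) : Prop :=
  forall p q : {mpoly F[3]}, f = p * p * q -> p \is a GRing.unit.

Definition act_form (g : 'M[F]_3) (f : {mpoly F[3]}) : {mpoly F[3]} :=
  f \mPo [tuple \sum_(j < 3) invmx g i j *: 'X_j | i < 3].

Definition coeffs6 (f : {mpoly F[3]}) : vec 'X_{1..3 < 7} :=
  [ffun m : 'X_{1..3 < 7} => f@_(val m)].

Definition sextic_stable (f : {mpoly F[3]}) : Prop :=
  git_stable (fun g : 'M[F]_3 => coeffs6 (act_form g f)).

End GIT.

(* Main.v *)
From HB Require Import structures.
Require Import Defs.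
From mathcomp Require Import all_boot perm all_algebra.
From mathcomp Require Import ring.
From mathcomp Require Import boolp classical_sets functions filter.
Set Implicit Arguments.
Unset Strict Implicit.
Unset Printing Implicit Defensive.
Import GRing.Theory.
Local Open Scope ring_scope.

(** The argument is valuative. If a point v lies in the Zariski closure of a
    family of points c(x), there are an ultrapower K of the base field F and a
    valuation ring R of K with residue field F in which the generic point of the
    family is integral and reduces to v. Closedness of an orbit and finiteness
    of a stabilizer both follow if every g in SL6(K) whose translate of the
    Pluecker point of the net A is integral has itself integral entries.
      Dividing by a 3 x 3 minor of maximal valuation gives s in SL3(K) such that
    s(gA) is an integral triple, so the sextic disc(sA) = disc(s(gA)) is integral.
    With s = a d b, a and b in SL3(R), d diagonal, every monomial m of disc(b0 A),
    b0 the reduction of b, has d^m integral. The reduction of d disc(b0 A) is in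
    the SL3-orbit of disc(A), as this orbit is closed, and its monomials satisfy
    d^m a unit; were d not integral, they would lie on a line and this sextic
    would be fixed by a one-parameter subgroup. So s, hence gA, is integral.
      If g were not integral, dividing g and its contragredient by an entry of
    maximal valuation and reducing would give (g, h) <> 0 with A g = h B and
    g^T h = 0. The image U of g is then isotropic for the net and orthogonal to
    ker h^T, which contains U: the pencil is block antitriangular and its
    determinant is divisible by a square, contradicting reducedness. *)

(** * Ultrapowers *)

Section Ultrapower.
Local Open Scope quotient_scope.
Variables (X : pointedType) (F : fieldType) (U : set_system X) (UU : UltraFilter U).

(** The proof that [U] is an ultrafilter is an argument because the ideal instance attached to this
    predicate depends on it. *)
Definition almost_zero of UltraFilter U : {pred X -> F} :=
  fun f => `[< U (fun x => f x = 0) >].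
Local Notation I := (almost_zero UU).

Lemma almost_zeroP f : reflect (U (fun x => f x = 0)) (f \in I).
Proof. exact: asboolP. Qed.

Lemma almost_zero_idealr_closed : idealr_closed I.
Proof.
split.
- by apply/almost_zeroP; apply: filterS filterT => x _.
- apply/almost_zeroP => U0; apply: (@filter_not_empty _ U).
  by apply: filterS U0 => x /eqP; rewrite oner_eq0.
- move=> h f g /almost_zeroP Uf /almost_zeroP Ug; apply/almost_zeroP.
  apply: filterS (filterI Uf Ug) => x [/= fx gx].
  by rewrite /GRing.add /= /GRing.mul /= fx gx mulr0 addr0.
Qed.

HB.instance Definition _ := isIdealr.Build (X -> F) I almost_zero_idealr_closed.

Definition ultrapower := {ideal_quot I}.
HB.instance Definition _ := GRing.ComNzRing.on ultrapower.

Definition ultraclass (f : X -> F) : ultrapower := \pi_{ideal_quot I} f.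

Lemma ultraclass_is_additive : zmod_morphism ultraclass.
Proof. by move=> f g; rewrite /ultraclass !piE. Qed.
HB.instance Definition _ :=
  GRing.isZmodMorphism.Build (X -> F) ultrapower ultraclass ultraclass_is_additive.

Lemma ultraclass_is_monoid_morphism : monoid_morphism ultraclass.
Proof. by split => [|f g]; rewrite /ultraclass !piE. Qed.
HB.instance Definition _ :=
  GRing.isMonoidMorphism.Build (X -> F) ultrapower ultraclass
    ultraclass_is_monoid_morphism.

Lemma ultraclass_eq0P f : reflect (U (fun x => f x = 0)) (ultraclass f == 0).
Proof.
apply: (iffP idP); last first.
  move=> Uf; rewrite -(rmorph0 ultraclass) /ultraclass piE Quotient.equivE subr0.
  exact/almost_zeroP.
rewrite -(rmorph0 ultraclass) /ultraclass piE Quotient.equivE subr0.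
by move/almost_zeroP.
Qed.

Definition ultrainv (y : ultrapower) := ultraclass (fun x => (repr y x)^-1).

Lemma ultrainv_mulVf y : y != 0 -> ultrainv y * y = 1.
Proof.
move=> y0; rewrite -{2}[y]reprK -/(ultraclass _) -rmorphM /=.
apply/eqP; rewrite -subr_eq0 -[X in _ - X](rmorph1 ultraclass) -rmorphB /=.
apply/ultraclass_eq0P.
(* An ultrafilter contains the zero set of the representative or its complement; the former would
   make [y] zero. *)
have [|Un0] := in_ultra_setVsetC (fun x => repr y x = 0) UU.
  by move/ultraclass_eq0P; rewrite /ultraclass reprK (negPf y0).
apply: filterS Un0 => x /= /eqP yx0.
by rewrite /GRing.add /= /GRing.opp /= /GRing.mul /= mulVf // subrr.
Qed.

Lemma ultrainv0 : ultrainv 0 = 0.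
Proof.
apply/eqP/ultraclass_eq0P.
have /ultraclass_eq0P : ultraclass (repr (0 : ultrapower)) == 0.
  by rewrite /ultraclass reprK.
by apply: filterS => x /= ->; rewrite invr0.
Qed.

HB.instance Definition _ :=
  GRing.ComNzRing_isField.Build ultrapower ultrainv_mulVf ultrainv0.

(** Replacing the zero values of a representative by 1 changes it only outside a set of [U]. This
    lifts diagonal matrices over the ultrapower to families of invertible ones. *)
Lemma ultraclass_nonzero_lift y :
  y != 0 -> exists2 f : X -> F, (forall x, f x != 0) & ultraclass f = y.
Proof.
move=> y0; exists (fun x => if repr y x == 0 then 1 else repr y x).
  by move=> x; case: ifPn => // _; rewrite oner_neq0.
apply/eqP; rewrite -[X in _ == X]reprK -/(ultraclass _) -subr_eq0 -rmorphB /=.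
apply/ultraclass_eq0P.
have [|Un0] := in_ultra_setVsetC (fun x => repr y x = 0) UU.
  by move/ultraclass_eq0P; rewrite /ultraclass reprK (negPf y0).
apply: filterS Un0 => x /= /eqP yx0.
by rewrite /GRing.add /= /GRing.opp /= (negPf yx0) subrr.
Qed.

End Ultrapower.

(** * Extension of places *)

Section PlaceExtension.
Variables (F : closedFieldType) (K : fieldType) (iota : {rmorphism F -> K}).
Local Notation A := (K * F)%type.

(** A place with values in [F] is encoded by its graph, a subring of the product that the last
    condition makes single-valued. Extending a place is then inclusion of sets, the form suited to
    Zorn's lemma. *)
Definition place_graph (G : set A) : Prop :=
  [/\ forall c, G (iota c, c), forall p q, G p -> G q -> G (p - q),
      forall p q, G p -> G q -> G (p * q) & forall a, G (0, a) -> a = 0].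

Section GraphTheory.
Variables (G : set A) (goodG : place_graph G).

Lemma graph_const c : G (iota c, c). Proof. by case: goodG. Qed.
Lemma graphB p q : G p -> G q -> G (p - q). Proof. by case: goodG => _ h _ _; exact: h. Qed.
Lemma graphM p q : G p -> G q -> G (p * q). Proof. by case: goodG => _ _ h _; exact: h. Qed.
Lemma graph_fun a : G (0, a) -> a = 0. Proof. by case: goodG => _ _ _; exact. Qed.
Lemma graph1 : G 1. Proof. by have := graph_const 1; rewrite rmorph1. Qed.
Lemma graph0 : G 0. Proof. by have := graph_const 0; rewrite rmorph0. Qed.
Lemma graphD p q : G p -> G q -> G (p + q).
Proof. by move=> Gp Gq; rewrite -[q]opprK -[- q]sub0r; do 2!apply: graphB => //; exact: graph0. Qed.
Lemma graph_sum I r (P : pred I) (f : I -> A) :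
  (forall i, P i -> G (f i)) -> G (\sum_(i <- r | P i) f i).
Proof. by move=> Gf; elim/big_ind: _ => //; [exact: graph0|exact: graphD]. Qed.
Lemma graphX p n : G p -> G (p ^+ n).
Proof. by move=> Gp; elim: n => [|n IH]; rewrite ?expr0 ?exprS; [exact: graph1|exact: graphM]. Qed.

Definition graph_poly (p : {poly A}) := forall i, G p`_i.

Lemma graph_polyB p q : graph_poly p -> graph_poly q -> graph_poly (p - q).
Proof. by move=> Gp Gq i; rewrite coefB; exact: graphB. Qed.
Lemma graph_polyM p q : graph_poly p -> graph_poly q -> graph_poly (p * q).
Proof. by move=> Gp Gq i; rewrite coefM; apply: graph_sum => j _; exact: graphM. Qed.
Lemma graph_polyC a : G a -> graph_poly a%:P.
Proof. by move=> Ga i; rewrite coefC; case: eqP => // _; exact: graph0. Qed.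

Definition adjoin (z : A) : set A := fun a => exists2 p, graph_poly p & a = p.[z].

Lemma sub_adjoin z a : G a -> adjoin z a.
Proof. by move=> Ga; exists a%:P; [exact: graph_polyC|rewrite hornerC]. Qed.

Lemma mem_adjoin z : adjoin z z.
Proof.
exists 'X; last by rewrite hornerX.
by move=> i; rewrite coefX; case: eqP => _; [exact: graph1|exact: graph0].
Qed.

Lemma adjoin_graph z :
  (forall p, graph_poly p -> (p.[z]).1 = 0 -> (p.[z]).2 = 0) -> place_graph (adjoin z).
Proof.
move=> hz; split.
- by move=> c; apply/sub_adjoin/graph_const.
- move=> _ _ [p Gp ->] [q Gq ->]; exists (p - q); first exact: graph_polyB.
  by rewrite hornerD hornerN.
- move=> _ _ [p Gp ->] [q Gq ->]; exists (p * q); first exact: graph_polyM.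
  by rewrite hornerM.
- by move=> a [p Gp e]; have := hz p Gp; rewrite -e => /(_ erefl).
Qed.

End GraphTheory.

Section Maximal.
Variables (G : set A) (goodG : place_graph G).
Hypothesis maxG : forall G', place_graph G' -> (forall a, G a -> G' a) ->
  forall a, G' a -> G a.

Lemma maximal_adjoin z :
  (forall p, graph_poly G p -> (p.[z]).1 = 0 -> (p.[z]).2 = 0) -> G z.
Proof.
move=> hz; apply: (maxG (adjoin_graph goodG hz)); last exact: mem_adjoin.
by move=> a; exact: sub_adjoin.
Qed.

Lemma fst_horner (p : {poly A}) z : (p.[z]).1 = (map_poly fst p).[z.1].
Proof. by rewrite horner_map. Qed.
Lemma snd_horner (p : {poly A}) z : (p.[z]).2 = (map_poly snd p).[z.2].
Proof. by rewrite horner_map. Qed.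

(* [unit_relation x n] : 1 lies in m[x], with m the ideal of the elements that
   the place sends to 0. *)
Definition unit_relation (x : K) (n : nat) :=
  exists p, [/\ graph_poly G p, (map_poly fst p).[x] = 0, map_poly snd p = 1
              & (size p <= n.+1)%N].

(** The residues of the polynomials over [G] that vanish at [x] form an ideal [J] of F[X]. If [J] is
    proper, its elements have a common root [a], as [F] is closed, and ([x], [a]) can be adjoined to
    [G]; otherwise [J] contains 1. *)
Lemma maximal_adjoin_or x : (exists a, G (x, a)) \/ exists n, unit_relation x n.
Proof.
pose J (r : {poly F}) :=
  exists p, [/\ graph_poly G p, (map_poly fst p).[x] = 0 & map_poly snd p = r].
have JB r s : J r -> J s -> J (r - s).
  move=> [p [Gp p0 <-]] [q [Gq q0 <-]]; exists (p - q); split.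
  - exact: graph_polyB.
  - by rewrite rmorphB /= hornerD hornerN p0 q0 subr0.
  - by rewrite rmorphB.
have JM r s : J r -> J (s * r).
  move=> [p [Gp p0 <-]]; exists (map_poly (fun c => (iota c, c)) s * p).
  have Gs : graph_poly G (map_poly (fun c => (iota c, c)) s).
    move=> i; rewrite coef_map_id0 ?rmorph0 //; exact: graph_const.
  split; first exact: graph_polyM.
  - by rewrite rmorphM /= hornerM p0 mulr0.
  - rewrite rmorphM /=; congr (_ * _); apply/polyP => i.
    by rewrite coef_map /= coef_map_id0 ?rmorph0.
have [J1|nJ1] := EM (J 1).
  right; case: J1 => p [Gp p0 p1]; exists (size p); exists p; split=> //.
left; suff [a ha] : exists a, forall r, J r -> r.[a] = 0.
  exists a; apply: maximal_adjoin => p Gp; rewrite fst_horner snd_horner /= => p0.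
  by apply: ha; exists p.
have [[r [Jr r0]]|nJ] := EM (exists r, J r /\ r != 0); last first.
  exists 0 => r Jr; have [->|r0] := eqVneq r 0; first by rewrite horner0.
  by case: nJ; exists r.
(* By Euclidean division, a nonzero element of [J] of least degree generates [J]. *)
have ex : exists n, `[< exists s, [/\ J s, s != 0 & size s = n]>].
  by exists (size r); apply/asboolP; exists r.
case: (ex_minnP ex) => n /asboolP[q [Jq q0 sq]] minn.
have /closed_rootP[a qa] : size q != 1.
  apply/negP => /size_poly1P[c c0 qE]; apply: nJ1.
  have := JM _ (c^-1)%:P Jq; rewrite qE -polyCM mulVf //.
exists a => s Js; suff -> : s = s %/ q * q by rewrite hornerM (eqP qa) mulr0.
rewrite {1}(divp_eq s q); suff -> : s %% q = 0 by rewrite addr0.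
apply/eqP/negPn/negP => m0.
have := ltn_modp s q; rewrite q0 sq ltnNge minn //; apply/asboolP.
exists (s %% q); split => //.
have -> : s %% q = s - (s %/ q) * q by rewrite {2}(divp_eq s q) addrC addKr.
exact/JB/JM.
Qed.

Lemma maximal_inv b c : G (b, c) -> c != 0 -> G (b^-1, c^-1).
Proof.
move=> Gbc c0; have b0 : b != 0.
  by apply: contra_neq c0 => b0; apply: (graph_fun goodG); rewrite -b0.
apply: maximal_adjoin => p Gp pz0.
(* A power of ([b], [c]) clears the denominators and gives an element of [G] with first component
   0. *)
have : G ((b, c) ^+ size p * p.[(b^-1, c^-1)]).
  rewrite horner_coef mulr_sumr; apply: graph_sum => // i _.
  rewrite mulrCA; apply: graphM => //.
  have -> : (b, c) ^+ size p * (b^-1, c^-1) ^+ i = (b, c) ^+ (size p - i) :> A.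
    rewrite -{1}(subnK (ltnW (ltn_ord i))) exprD -mulrA -exprMn.
    have -> : (b, c) * (b^-1, c^-1) = 1 :> A.
      by congr (_, _); rewrite /= divff.
    by rewrite expr1n mulr1.
  exact: graphX.
have -> : (b, c) ^+ size p * p.[(b^-1, c^-1)] =
   (0, c ^+ size p * (p.[(b^-1, c^-1)]).2) :> A.
  rewrite [LHS]surjective_pairing; congr (_, _); first by rewrite [LHS]/= pz0 mulr0.
  by rewrite [LHS]/=; congr (_ * _); exact: (rmorphXn (@snd K F)).
by move/(graph_fun goodG)/eqP; rewrite mulf_eq0 expf_eq0 (negPf c0) andbF /= => /eqP.
Qed.

(** Chevalley's argument: the shorter of the two relations, reversed, lowers the degree of the
    longer one. The descent ends at a constant relation, which would put (0, 1) in [G]. *)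
Lemma no_two_unit_relations x m n :
  x != 0 -> unit_relation x m -> unit_relation x^-1 n -> False.
Proof.
have [N] := ubnP (m + n); elim: N x m n => // N IH x m n le_mn x0 Rx Ry.
wlog le_nm : x m n le_mn x0 Rx Ry / (n <= m)%N.
  move=> W; have [|/ltnW] := leqP n m; first exact: W Rx Ry.
  by apply: (W x^-1 n m); rewrite ?invr_eq0 ?invrK // addnC.
case: m => [|m] in le_mn le_nm Rx.
  case: Rx => p [Gp p0 p1] /size1_polyC pE.
  have := Gp 0%N; rewrite [p`_0]surjective_pairing.
  have -> : (p`_0).1 = 0 by move: p0; rewrite {1}pE map_polyC hornerC.
  move/(graph_fun goodG)/eqP.
  have -> : (p`_0).2 = (map_poly snd p)`_0 by rewrite coef_map.
  by rewrite p1 coefC eqxx oner_eq0.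
case: Rx => p [Gp p0 p1 sp]; case: Ry => q [Gq q0 q1 sq].
pose b := (q`_0).1.
have q0E : q`_0 = (b, 1).
  rewrite [LHS]surjective_pairing; congr (_, _).
  have -> : (q`_0).2 = (map_poly snd q)`_0 by rewrite coef_map.
  by rewrite q1 coefC eqxx.
have Gb : G (b^-1, 1).
  have := Gq 0%N; rewrite q0E => /maximal_inv; rewrite oner_eq0 invr1; exact.
have b0 : b != 0.
  apply/eqP => b0; have := Gq 0%N; rewrite q0E b0 => /(graph_fun goodG)/eqP.
  by rewrite oner_eq0.
(* This is X^(m+1) q(1/X), whose first component vanishes at [x]; its top coefficient ([b], 1) has
   an inverse in [G]. *)
pose rq := \poly_(i < m.+2) q`_(m.+1 - i).
have Grq : graph_poly G rq.
  by move=> i; rewrite coef_poly; case: ifP => _ //; exact: graph0.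
have rq0 : (map_poly fst rq).[x] = 0.
  have -> : (map_poly fst rq).[x] = x ^+ m.+1 * (map_poly fst q).[x^-1].
    rewrite (horner_coef_wide _ (leq_trans (size_poly _ _) (size_poly _ _))).
    rewrite (@horner_coef_wide _ m.+2) ?mulr_sumr; last first.
      by apply: leq_trans (size_poly _ _) (leq_trans sq _).
    rewrite (reindex_inj rev_ord_inj) /=; apply: eq_bigr => i _.
    rewrite !coef_map /= coef_poly subSS ltnS leq_subr subKn; last by rewrite -ltnS.
    rewrite mulrCA; congr (_ * _).
    by rewrite exprVn expfB_cond // (negPf x0) -ltnS ltn_ord.
  by rewrite q0 mulr0.
(* The top coefficient of [p] cancels. Its residue is 0, so the residue polynomial of [p'] is still
   1. *)
pose p' := p - (p`_m.+1 * (b^-1, 1))%:P * rq.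
apply: (IH x m n) => //; [exists p'; split|by exists q].
- by apply: graph_polyB => //; apply: graph_polyM => //; apply: graph_polyC => //; exact: graphM.
- by rewrite /p' rmorphB rmorphM /= hornerD hornerN hornerM rq0 p0 mulr0 subr0.
- rewrite /p' rmorphB rmorphM /= p1 map_polyC /=.
  have -> : (p`_m.+1).2 = (map_poly snd p)`_m.+1 by rewrite coef_map.
  by rewrite p1 coefC mul0r mul0r subr0.
- apply/leq_sizeP => j; rewrite leq_eqVlt => /predU1P[<-|lt_mj].
  + rewrite /p' coefB coefCM coef_poly ltnSn subnn q0E -mulrA.
    have -> : (b^-1, 1) * (b, 1) = 1 :> A.
      by congr (_, _); rewrite /= ?mulVf ?mulr1.
    by rewrite mulr1 subrr.
  + rewrite /p' coefB coefCM coef_poly ltnNge lt_mj mulr0 subr0.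
    by apply: (leq_sizeP _ _ sp).
Qed.

Lemma maximal_valuative x : (exists a, G (x, a)) \/ x != 0 /\ G (x^-1, 0).
Proof.
have [?|[m Rx]] := maximal_adjoin_or x; [by left|].
have x0 : x != 0.
  apply/eqP => x0; case: Rx => p [Gp]; rewrite x0 horner_coef0 coef_map /= => p0 p1.
  move=> _; have := Gp 0%N; rewrite [p`_0]surjective_pairing p0.
  move/(graph_fun goodG)/eqP.
  have -> : (p`_0).2 = (map_poly snd p)`_0 by rewrite coef_map.
  by rewrite p1 coefC eqxx oner_eq0.
have [[a Ga]|[n Ry]] := maximal_adjoin_or x^-1; last first.
  by case: (no_two_unit_relations x0 Rx Ry).
have [a0|a0] := eqVneq a 0; first by right; split; rewrite -?a0.
by left; exists a^-1; rewrite -[x]invrK; exact: maximal_inv.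
Qed.
End Maximal.

Lemma place_graph_extension (G0 : set A) : place_graph G0 ->
  exists G, [/\ place_graph G, forall a, G0 a -> G a
              & forall x, (exists a, G (x, a)) \/ x != 0 /\ G (x^-1, 0)].
Proof.
move=> goodG0.
pose P (G : set A) := place_graph G /\ (forall a, G0 a -> G a).
pose Q (G : set A) := G = set0 \/ P G.
have [|G [QG maxG]] := @Zorn_bigcup A Q.
  move=> C CQ Ctot.
  have [[G1 [CG1 PG1]]|nC] := EM (exists G, C G /\ P G).
    right; split; last by move=> a G0a; exists G1 => //; apply PG1.2.
    have CP G a : C G -> G a -> P G.
      by move=> CG Ga; case: (CQ _ CG) => // G0'; rewrite G0' in Ga.
    have common p q : (\bigcup_(Y in C) Y)%classic p -> (\bigcup_(Y in C) Y)%classic q ->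
        exists G, [/\ C G, P G, G p & G q].
      move=> [G CG Gp] [H CH Hq].
      have [GH|HG] := Ctot _ _ CG CH.
        by exists H; split => //; [exact: CP Hq|exact: GH].
      by exists G; split => //; [exact: CP Gp|exact: HG].
    split.
    + by move=> c; exists G1 => //; apply: graph_const; exact: PG1.1.
    + move=> p q Cp Cq; have [G [CG PG Gp Gq]] := common _ _ Cp Cq.
      by exists G => //; apply: graphB => //; exact: PG.1.
    + move=> p q Cp Cq; have [G [CG PG Gp Gq]] := common _ _ Cp Cq.
      by exists G => //; apply: graphM => //; exact: PG.1.
    + by move=> a [G CG Ga]; apply: (graph_fun (CP _ _ CG Ga).1).
  left; rewrite predeqE => a; split => // -[G CG Ga].
  case: (CQ _ CG) => [G0'|PG]; first by rewrite G0' in Ga.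
  by case: nC; exists G.
have PG : P G.
  case: QG => // GE; have := maxG G0; case; last by right; split.
  rewrite GE; split => [a //|/(_ (iota 0, 0))]; apply.
  exact: (graph_const goodG0).
exists G; split; [exact: PG.1|exact: PG.2|].
apply: maximal_valuative; first exact: PG.1.
move=> G' goodG' GG' a G'a; apply: contrapT => nGa.
apply: (maxG G'); last by right; split => // b /PG.2; exact: GG'.
by split => [|/(_ a G'a)].
Qed.
End PlaceExtension.

(** * The valuation ring of a place *)

Section GraphRing.
Variables (F : closedFieldType) (K : fieldType) (iota : {rmorphism F -> K}).
Variables (G : set (K * F)) (goodG : place_graph iota G).

Definition graph_pred of place_graph iota G : {pred K * F} := fun a => `[< G a >].

Lemma graph_pred_subring : subring_closed (graph_pred goodG).
Proof.
split; first by apply/asboolP; exact: graph1 goodG.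
- by move=> a b /asboolP Ga /asboolP Gb; apply/asboolP; exact: (graphB goodG).
- by move=> a b /asboolP Ga /asboolP Gb; apply/asboolP; exact: (graphM goodG).
Qed.
HB.instance Definition _ :=
  GRing.isSubringClosed.Build (K * F)%type (graph_pred goodG) graph_pred_subring.

(** Elements are pairs of a value and its residue, so the inclusion in [K] and the residue map are
    the two projections. *)
Record graph_ring := GraphRing {
  graph_val : (K * F)%type; graph_valP : graph_val \in graph_pred goodG }.
HB.instance Definition _ := [isSub for graph_val].
HB.instance Definition _ := [Choice of graph_ring by <:].
HB.instance Definition _ := [SubChoice_isSubComNzRing of graph_ring by <:].

Lemma graph_mem a : G a -> exists z : graph_ring, val z = a.
Proof. by move=> /asboolP Ga; exists (GraphRing Ga). Qed.

Definition graph_cst (c : F) : graph_ring :=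
  GraphRing (introT (asboolP _) (graph_const goodG c)).

Lemma graph_cst_is_zmod_morphism : zmod_morphism graph_cst.
Proof. by move=> a b; apply: val_inj; rewrite /= rmorphB. Qed.
HB.instance Definition _ := GRing.isZmodMorphism.Build F graph_ring graph_cst
  graph_cst_is_zmod_morphism.
Lemma graph_cst_is_monoid_morphism : monoid_morphism graph_cst.
Proof. by split=> [|a b]; apply: val_inj; rewrite /= ?rmorph1 ?rmorphM. Qed.
HB.instance Definition _ := GRing.isMonoidMorphism.Build F graph_ring graph_cst
  graph_cst_is_monoid_morphism.

Lemma graph_fst_inj : injective (fst \o val : graph_ring -> K).
Proof.
move=> y z /= yz; apply: val_inj; apply/eqP; rewrite -subr_eq0.
have /asboolP : val (y - z) \in graph_pred goodG by exact: graph_valP.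
rewrite rmorphB /= => Gyz; rewrite [X in X == 0]surjective_pairing.
have e : (val y - val z).1 = 0 by rewrite /= yz subrr.
rewrite e; apply/eqP; congr (_, _); apply: (graph_fun goodG).
by rewrite -e -surjective_pairing.
Qed.
End GraphRing.

(* [pl_field] is the field of values of the "moving" points (an ultrapower of F
   over the index set X), [pl_ring] its valuation ring, with residue field F. *)
Record place (F : fieldType) (X : pointedType) := Place {
  pl_field : fieldType;
  pl_class : {rmorphism (X -> F) -> pl_field};
  pl_ring : comNzRingType;
  pl_val : {rmorphism pl_ring -> pl_field};
  pl_res : {rmorphism pl_ring -> F};
  pl_cst : {rmorphism F -> pl_ring};
  pl_val_inj : injective pl_val;
  pl_cstK : cancel pl_cst pl_res;
  pl_val_cst : forall a, pl_val (pl_cst a) = pl_class (fun=> a);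
  pl_valuative : forall y, (exists z, y = pl_val z) \/
    y != 0 /\ exists2 z, y^-1 = pl_val z & pl_res z = 0;
  pl_nonzero_lift : forall y, y != 0 ->
    exists2 f : X -> F, (forall x, f x != 0) & pl_class f = y }.

Arguments pl_val_inj {F X} p.
Arguments pl_cstK {F X} p.
Arguments pl_val_cst {F X} p.
Arguments pl_valuative {F X} p.
Arguments pl_nonzero_lift {F X} p.

(** * Places centred at a point of a Zariski closure *)

Section PlaceExistence.
Variables (F : closedFieldType) (X : pointedType) (I : finType).
Variables (c : X -> vec F I) (v : vec F I).
Hypothesis adherent :
  forall P : vec F I -> F, polyfun P -> (forall x, P (c x) = 0) -> P v = 0.

Lemma polyfun_opp (P : vec F I -> F) : polyfun P -> polyfun (fun w => - P w).
Proof.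
move=> PP; have := pf_mul (pf_const I (-1)) PP.
by congr polyfun; apply/funext => w; rewrite mulN1r.
Qed.

(** The sets where P(c x) is nonzero, for P with P(v) nonzero, are nonempty by adherence, and a
    product of polynomials handles intersections. Any ultrafilter containing them works. *)
Lemma adherent_ultrafilter : exists U : set_system X, UltraFilter U /\
  forall P : vec F I -> F, polyfun P -> U (fun x => P (c x) = 0) -> P v = 0.
Proof.
pose D := fun P : vec F I -> F => polyfun P /\ P v <> 0.
pose B := fun (P : vec F I -> F) x => P (c x) <> 0.
have Fil : ProperFilter (filter_from D B).
  apply: filter_from_proper; last first.
    move=> P [PP Pv]; apply: contrapT => nB; apply: Pv; apply: adherent => // x.
    by apply: contrapT => Px; apply: nB; exists x.
  apply: filter_from_filter.
    exists (fun _ => 1); split; first exact: pf_const.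
    by move/eqP; rewrite oner_eq0.
  move=> P Q [PP Pv] [PQ Qv]; exists (fun w => P w * Q w).
    split; first exact: pf_mul.
    by move/eqP; rewrite mulf_eq0 => /orP[] /eqP.
  by move=> x Bx; split => e; apply: Bx; rewrite e ?mul0r ?mulr0.
have [U [UU sU]] := ultraFilterLemma Fil.
exists U; split => // P PP UP; apply: contrapT => Pv.
have UB : U (B P) by apply: sU; exists P.
by apply: (@filter_not_empty _ U); apply: filterS (filterI UP UB) => x [].
Qed.

Theorem adherent_place : exists pl : place F X,
  forall i, exists2 z, pl_val pl z = pl_class pl (fun x => c x i) & pl_res pl z = v i.
Proof.
have [U [UU Uv]] := adherent_ultrafilter.
pose K := @ultrapower X F U UU.
pose cls : {rmorphism (X -> F) -> K} := @ultraclass X F U UU.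
pose cst0 (a : F) : X -> F := fun=> a.
have cstB : zmod_morphism cst0 by [].
have cstM : monoid_morphism cst0 by [].
pose cstL : {rmorphism F -> (X -> F)} := HB.pack cst0
  (GRing.isZmodMorphism.Build _ _ _ cstB) (GRing.isMonoidMorphism.Build _ _ _ cstM).
pose iota : {rmorphism F -> K} := cls \o cstL.
(* The specialization of the generic point of the family to [v]; the choice of [U] makes it
   single-valued. *)
pose G0 : set (K * F) := fun a => exists2 P : vec F I -> F, polyfun P &
  a = (cls (fun x => P (c x)), P v).
have goodG0 : place_graph iota G0.
  split.
  - by move=> a; exists (fun=> a); first exact: pf_const.
  - move=> _ _ [P PP ->] [Q PQ ->]; exists (fun w => P w - Q w).
      by apply: pf_add => //; exact: polyfun_opp.
    by congr (_, _); rewrite /= -rmorphB.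
  - move=> _ _ [P PP ->] [Q PQ ->]; exists (fun w => P w * Q w).
      exact: pf_mul.
    by congr (_, _); rewrite /= -rmorphM.
  - by move=> a [P PP [/esym/eqP/ultraclass_eq0P P0 ->]]; exact: Uv.
have [G [goodG sG Gval]] := place_graph_extension goodG0.
pose R := graph_ring goodG.
pose vl : {rmorphism R -> K} := fst \o (val : {rmorphism R -> (K * F)%type}).
pose rs : {rmorphism R -> F} := snd \o (val : {rmorphism R -> (K * F)%type}).
pose cs : {rmorphism F -> R} := graph_cst goodG.
have valuative y : (exists z, y = vl z) \/
    y != 0 /\ exists2 z, y^-1 = vl z & rs z = 0.
  case: (Gval y) => [[a /(graph_mem goodG)[z zE]]|[y0 /(graph_mem goodG)[z zE]]].
    by left; exists z; rewrite /= zE.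
  by right; split => //; exists z; rewrite /= zE.
exists (@Place F X K cls R vl rs cs (@graph_fst_inj _ _ _ _ goodG)
  (fun a => erefl) (fun a => erefl) valuative (@ultraclass_nonzero_lift X F U UU)).
move=> i; have /sG/(graph_mem goodG)[z zE] : G0 (cls (fun x => c x i), v i).
  by exists (fun w => w i); first exact: pf_coord.
by exists z; rewrite /= zE.
Qed.
End PlaceExistence.

(** * Discriminants of degenerate nets *)

Section Degeneration.

(** With rows in the order U, Y, Z and columns in the order Z, Y, U, the Gram matrix is block lower
    triangular; its diagonal blocks are [U *m A *m Z^T], [Y *m A *m Y^T] and the transpose of the
    first. *)
Lemma det_antitriangular (S : comNzRingType) r s (A : 'M[S]_(r + (s + r)))
    (U Z : 'M_(r, r + (s + r))) (Y : 'M_(s, r + (s + r))) :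
  A^T = A -> U *m A *m U^T = 0 -> U *m A *m Y^T = 0 ->
  \det (col_mx U (col_mx Y Z)) * \det A * \det (col_mx Z (col_mx Y U)) =
  \det (U *m A *m Z^T) ^+ 2 * \det (Y *m A *m Y^T).
Proof.
move=> symA UU UY.
have YU : Y *m A *m U^T = 0.
  by apply: trmx_inj; rewrite !trmx_mul symA trmxK mulmxA UY trmx0.
have ZU : Z *m A *m U^T = (U *m A *m Z^T)^T.
  by rewrite !trmx_mul symA trmxK mulmxA.
rewrite -[\det (col_mx Z _)]det_tr -!det_mulmx !tr_col_mx mul_col_mx mul_col_row.
rewrite mul_mx_row UU UY row_mx0 det_lblock mul_col_mx mul_col_row YU.
by rewrite ZU det_lblock det_tr mulrA mulrAC expr2.
Qed.

(** [U] spans the image of [g], which lies in the left kernel of [h]; [Y] completes it to that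
    kernel and [Z] spans a complement of the kernel. Equality of the ranks gives [U] and [Z] equally
    many rows. *)
Lemma isotropic_flag (F : fieldType) n (g h : 'M[F]_n) :
  g^T *m h = 0 -> \rank g = \rank h ->
  exists r s (U Z : 'M_(r, n)) (Y : 'M_(s, n)),
    [/\ r = \rank g, n = (r + (s + r))%N, row_full (col_mx U (col_mx Y Z)),
        row_full (col_mx Z (col_mx Y U))
      & [/\ (U <= g^T)%MS, (U <= kermx h)%MS & (Y <= kermx h)%MS]].
Proof.
move=> gh rk; pose U := row_base g^T.
have sU : (U <= kermx h)%MS.
  by apply/sub_kermxP/eqP; rewrite -submx0 -gh submxMr // eq_row_base.
pose D := (kermx h :\: U)%MS; pose Y := row_base D.
pose E := ((kermx h)^C)%MS.
have rU : \rank g^T = \rank g by rewrite mxrank_tr.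
have rE : \rank E = \rank g.
  by rewrite mxrank_compl mxrank_ker rk subKn // rank_leq_row.
have rD : (\rank g + \rank D = n - \rank g)%N.
  rewrite [in RHS]rk -mxrank_ker -(mxrank_cap_compl (kermx h) U); congr (_ + _)%N.
  by rewrite (capmx_idPr sU) (eq_row_base g^T).1 mxrank_tr.
pose U' := castmx (rU, erefl n) U.
pose Z := castmx (rE, erefl n) (row_base E).
have eU : (U' :=: U)%MS by exact: eqmx_cast.
have eZ : (Z :=: E)%MS by apply: eqmx_trans (eqmx_cast _ _) (eq_row_base _).
have eY : (Y :=: D)%MS by exact: eq_row_base.
have full : row_full (U' + Y + Z)%MS.
  rewrite -sub1mx (adds_eqmx (adds_eqmx eU eY) eZ).
  apply: submx_trans (_ : (kermx h + E <= _)%MS).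
    by rewrite sub1mx addsmx_compl_full.
  apply: addsmxS => //; rewrite -{1}(addsmx_diff_cap_eq (kermx h) U) addsmxC.
  by rewrite addsmxS // capmxSr.
exists (\rank g), (\rank D), U', Z, Y; split => //.
- by rewrite addnA rD subnK // rank_leq_row.
- by rewrite -sub1mx -addsmxE -(adds_eqmx (eqmx_refl U') (addsmxE Y Z)) addsmxA sub1mx.
- rewrite -sub1mx -addsmxE -(adds_eqmx (eqmx_refl Z) (addsmxE Y U')) addsmxC.
  by rewrite (addsmxC Y) sub1mx.
- by split; [rewrite eU eq_row_base | rewrite eU | rewrite eY diffmxSl].
Qed.

Lemma row_full_unitmx (F : fieldType) n (A : 'M[F]_n) : row_full A -> \det A != 0.
Proof. by rewrite row_full_unit unitmxE unitfE. Qed.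
End Degeneration.

(* [pencil] and [disc] are locked: conversion would otherwise expand determinants
   of polynomial matrices. *)
HB.lock Definition pencil (S : nzRingType) m n (M : 'I_3 -> 'M[S]_(m, n)) :
  'M[{mpoly S[3]}]_(m, n) :=
  \sum_r 'X_r *: map_mx (@mpolyC 3 S) (M r).

Lemma pencilE (S : nzRingType) m n (M : 'I_3 -> 'M[S]_(m, n)) :
  pencil M = \sum_r 'X_r *: map_mx (@mpolyC 3 S) (M r).
Proof. by rewrite pencil.unlock. Qed.

Lemma pencil_entry (S : nzRingType) m n (M : 'I_3 -> 'M[S]_(m, n)) i j :
  pencil M i j = \sum_r 'X_r * (M r i j)%:MP.
Proof. by rewrite pencilE summxE; apply: eq_bigr => r _; rewrite !mxE. Qed.

HB.lock Definition disc (S : comNzRingType) n (M : 'I_3 -> 'M[S]_n) : {mpoly S[3]} :=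
  \det (pencil M).

Lemma discE (S : comNzRingType) n (M : 'I_3 -> 'M[S]_n) : disc M = \det (pencil M).
Proof. by rewrite disc.unlock. Qed.

Section Pencil.

Lemma pencil_mul (S : comNzRingType) m n p q (U : 'M[S]_(m, n)) (V : 'M[S]_(p, q)) M :
  pencil (fun r => U *m M r *m V) =
    map_mx (@mpolyC 3 S) U *m pencil M *m map_mx (@mpolyC 3 S) V.
Proof.
rewrite !pencilE mulmx_sumr mulmx_suml; apply: eq_bigr => r _.
by rewrite -scalemxAr -scalemxAl !map_mxM.
Qed.

Lemma pencil_mulr (S : comNzRingType) m n p (V : 'M[S]_(n, p)) (M : 'I_3 -> 'M[S]_(m, n)) :
  pencil (fun r => M r *m V) = pencil M *m map_mx (@mpolyC 3 S) V.
Proof.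
rewrite !pencilE mulmx_suml; apply: eq_bigr => r _.
by rewrite -scalemxAl map_mxM.
Qed.

Lemma pencil_mull (S : comNzRingType) m n p (U : 'M[S]_(p, m)) (M : 'I_3 -> 'M[S]_(m, n)) :
  pencil (fun r => U *m M r) = map_mx (@mpolyC 3 S) U *m pencil M.
Proof.
rewrite !pencilE mulmx_sumr; apply: eq_bigr => r _.
by rewrite -scalemxAr map_mxM.
Qed.

Lemma map_pencil (S T : nzRingType) (f : {rmorphism S -> T}) m n (M : 'I_3 -> 'M[S]_(m, n)) :
  map_mx (map_mpoly f) (pencil M) = pencil (fun r => map_mx f (M r)).
Proof.
apply/matrixP => i j; rewrite !pencilE !mxE !summxE rmorph_sum; apply: eq_bigr => r _.
by rewrite !mxE rmorphM /= map_mpolyX map_mpolyC.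
Qed.

Lemma map_disc (S T : comNzRingType) (f : {rmorphism S -> T}) n (M : 'I_3 -> 'M[S]_n) :
  map_mpoly f (disc M) = disc (fun r => map_mx f (M r)).
Proof. by rewrite !discE -map_pencil det_map_mx. Qed.

Lemma tr_pencil (S : comNzRingType) m n (M : 'I_3 -> 'M[S]_(m, n)) :
  (pencil M)^T = pencil (fun r => (M r)^T).
Proof.
rewrite !pencilE linear_sum; apply: eq_bigr => r _; rewrite linearZ /=; congr (_ *: _).
by apply/matrixP => i j; rewrite !mxE.
Qed.

Lemma pencil_ext (S : nzRingType) m n (M N : 'I_3 -> 'M[S]_(m, n)) :
  M =1 N -> pencil M = pencil N.
Proof. by move=> e; rewrite !pencilE; apply: eq_bigr => r _; rewrite e. Qed.

Lemma disc_ext (S : comNzRingType) n (M N : 'I_3 -> 'M[S]_n) : M =1 N -> disc M = disc N.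
Proof. by move=> e; rewrite !discE (pencil_ext e). Qed.

Lemma pencil0 (S : nzRingType) m n : pencil (fun=> 0 : 'M[S]_(m, n)) = 0.
Proof. by rewrite !pencilE big1 // => r _; rewrite raddf0 scaler0. Qed.

Lemma disc_conj (S : comNzRingType) n (g : 'M[S]_n) M :
  disc (fun r => g^T *m M r *m g) = (\det g)%:MP ^+ 2 * disc M.
Proof.
by rewrite !discE pencil_mul !det_mulmx -map_trmx det_tr det_map_mx mulrAC -expr2.
Qed.

Lemma disc_conj1 (S : comNzRingType) n (g : 'M[S]_n) M :
  \det g = 1 -> disc (fun r => g^T *m M r *m g) = disc M.
Proof. by move=> g1; rewrite disc_conj g1 mpolyC1 expr1n mul1r. Qed.

(** Here the conjugating matrix lives in a larger ring than the two nets; the discriminants are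
    compared there and brought back by injectivity. *)
Lemma disc_conj1_map (S T : comNzRingType) (f : {rmorphism S -> T}) n
    (M N : 'I_3 -> 'M[S]_n) (g : 'M[T]_n) :
  injective f -> \det g = 1 ->
  (forall i, g^T *m map_mx f (M i) *m g = map_mx f (N i)) -> disc N = disc M.
Proof.
move=> f_inj g1 gMg.
have e1 := disc_ext gMg.
have e2 := disc_conj1 (fun i => map_mx f (M i)) g1.
have e3 : map_mpoly f (disc N) = map_mpoly f (disc M).
  by rewrite (map_disc f N) -e1 e2 (map_disc f M).
by apply/mpolyP => m; apply: f_inj; rewrite -!mcoeff_map_mpoly e3.
Qed.

(** Shows that a discriminant is not a unit. The size is positive, since the empty determinant is
    1. *)
Lemma disc_eval0 (S : comNzRingType) n (M : 'I_3 -> 'M[S]_n.+1) :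
  (disc M).@[fun=> 0] = 0.
Proof.
rewrite discE -det_map_mx.
have -> : map_mx (meval (fun=> 0)) (pencil M) = 0.
  apply/matrixP => i j; rewrite pencilE !mxE summxE rmorph_sum big1 // => r _.
  by rewrite !mxE rmorphM /= mevalXU mul0r.
by rewrite det0.
Qed.
End Pencil.

(** * Nets with a reduced discriminant *)

Section Reduced.
Variable F : fieldType.

(** Applied to the pencil, [det_antitriangular] exhibits, up to a nonzero constant, the square of
    the discriminant of [U *m M i *m Z^T] as a factor of [disc M]. That factor vanishes at the
    origin because [U] has at least one row, so it is not a unit. *)
Lemma reduced_antitriangular n r s (M : 'I_3 -> 'M[F]_n)
    (U Z : 'M_(r.+1, n)) (Y : 'M_(s, n)) :
  n = (r.+1 + (s + r.+1))%N -> (forall i, (M i)^T = M i) ->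
  (forall i, U *m M i *m U^T = 0) -> (forall i, U *m M i *m Y^T = 0) ->
  row_full (col_mx U (col_mx Y Z)) -> row_full (col_mx Z (col_mx Y U)) ->
  ~ reduced (disc M).
Proof.
move=> en; case: _ / (esym en) in M U Z Y * => symM UU UY.
move=> /row_full_unitmx dP /row_full_unitmx dQ redM.
pose P := col_mx U (col_mx Y Z); pose Q := col_mx Z (col_mx Y U).
pose C := @mpolyC 3 F.
have eqd : C (\det P) * disc M * C (\det Q) =
    disc (fun i => U *m M i *m Z^T) ^+ 2 * disc (fun i => Y *m M i *m Y^T).
  rewrite !discE.
  have := @det_antitriangular _ _ _ (pencil M) (map_mx C U) (map_mx C Z) (map_mx C Y).
  rewrite tr_pencil (pencil_ext symM) -!map_col_mx !det_map_mx !map_trmx -!pencil_mul.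
  apply => //.
    by rewrite (pencil_ext UU) pencil0.
  by rewrite (pencil_ext UY) pencil0.
have /redM : disc M = disc (fun i => U *m M i *m Z^T) * disc (fun i => U *m M i *m Z^T)
    * (disc (fun i => Y *m M i *m Y^T) * C ((\det P)^-1 * (\det Q)^-1)).
  have e : C (\det P) * (C (\det Q) * C ((\det P)^-1 * (\det Q)^-1)) = 1.
    by rewrite /C -!mpolyCM mulrA mulrACA divff // divff // mulr1.
  by rewrite -expr2 mulrA -eqd [C (\det P) * _]mulrC -!mulrA e mulr1.
move=> u; have : (disc (fun i => U *m M i *m Z^T)).@[fun=> 0] \is a GRing.unit.
  exact: (rmorph_unit (meval (fun=> 0)) u).
by rewrite disc_eval0 unitr0.
Qed.

Lemma reduced_neq0 (f : {mpoly F[3]}) : reduced f -> f != 0.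
Proof.
move=> redf; apply/eqP => f0; have /redf : f = 0 * 0 * 0 by rewrite f0 mulr0.
by rewrite unitr0.
Qed.

Lemma embed_in_field (D : idomainType) :
  exists (L : fieldType) (f : {rmorphism D -> L}), injective f.
Proof.
exists {fraction D}, (@tofrac D) => x y /eqP; rewrite tofrac_eq; exact: eqP.
Qed.

Lemma rank_intertwining (L : fieldType) n (A B g h : 'M[L]_n) :
  A \in unitmx -> B \in unitmx -> A *m g = h *m B -> \rank g = \rank h.
Proof.
rewrite -row_full_unit -row_free_unit => fA fB e.
by rewrite -(eqmxMfull g fA) e mxrankMfree.
Qed.

(** Both pencils are invertible over the field of rational functions, so [g] and [h] have the same
    rank and [isotropic_flag] applies. Reducedness then forces this rank to be 0. *)
Lemma reduced_no_degeneration n (M N : 'I_3 -> 'M[F]_n) g h :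
  (forall i, (M i)^T = M i) -> reduced (disc M) -> disc N = disc M ->
  (forall i, M i *m g = h *m N i) -> g^T *m h = 0 -> g = 0 /\ h = 0.
Proof.
move=> symM redM discN MgN gh.
have d0 := reduced_neq0 redM.
have [L [f f_inj]] := embed_in_field {mpoly F[3]}.
have inv_pencil (K : 'I_3 -> 'M[F]_n) : disc K = disc M -> map_mx f (pencil K) \in unitmx.
  move=> e; rewrite unitmxE det_map_mx -discE e unitfE.
  by rewrite -(rmorph0 f) (inj_eq f_inj).
have pen := etrans (esym (pencil_mulr g M)) (etrans (pencil_ext MgN) (pencil_mull h N)).
have [c cE] : exists c : {rmorphism F -> L}, c =1 f \o @mpolyC 3 F.
  by exists (f \o @mpolyC 3 F).
have map_c (A : 'M_n) : map_mx f (map_mx (@mpolyC 3 F) A) = map_mx c A.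
  by apply/matrixP => i j; rewrite !mxE cE.
have rk : \rank g = \rank h.
  have := congr1 (map_mx f) pen; rewrite !(map_mxM f) !map_c => e.
  rewrite -(mxrank_map c g) -(mxrank_map c h).
  exact: rank_intertwining (inv_pencil M erefl) (inv_pencil N discN) e.
have [r [s [U [Z [Y [rE en fullP fullQ [Ug Uh Yh]]]]]]] := isotropic_flag gh rk.
(* The image of [g] is orthogonal, for every form of the net, to the left kernel of [h]: transposing
   [M i *m g = h *m N i] brings out the factor [V *m h]. *)
have Uk (k : nat) (V : 'M_(k, n)) i : (V <= kermx h)%MS -> U *m M i *m V^T = 0.
  move=> /sub_kermxP Vh; have /submxP[D ->] := Ug.
  have -> : D *m g^T *m M i = D *m (M i *m g)^T by rewrite trmx_mul symM mulmxA.
  by rewrite MgN trmx_mul -!mulmxA -trmx_mul Vh trmx0 !mulmx0.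
case: r => [|r] in U Z rE en fullP fullQ Ug Uh Uk *.
  by split; apply/eqP; rewrite -mxrank_eq0 -?rk -rE.
by case: (reduced_antitriangular en symM (fun i => Uk _ _ i Uh)
  (fun i => Uk _ _ i Yh) fullP fullQ).
Qed.
End Reduced.

(** * Integral matrices over a valuation ring *)

Section Integrality.
Variables (F : fieldType) (X : pointedType) (pl : place F X).
Local Notation K := (pl_field pl).
Local Notation R := (pl_ring pl).
Local Notation val := (pl_val pl).
Local Notation res := (pl_res pl).
Local Notation cst := (pl_cst pl).

Definition integral (x : K) := exists z : R, x = val z.

Lemma integral_unit_factor (u : R) x : res u != 0 -> integral (val u * x) -> integral x.
Proof.
move=> u0 [z xz]; have [//|[x0 [y xy y0]]] := pl_valuative pl x.
case/negP: u0; suff -> : u = z * y by rewrite rmorphM /= y0 mulr0.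
by apply: (pl_val_inj pl); rewrite rmorphM /= -xz -xy mulfK.
Qed.

(** Of two nonzero elements of [K], one divides the other with integral quotient, so some nonzero
    member of the family divides all the others. *)
Lemma integral_max (I : finType) (f : I -> K) : (exists i, f i != 0) ->
  exists2 i0, f i0 != 0 & forall i, exists z, f i = f i0 * val z.
Proof.
move=> [i fi]; suff /(_ (enum I))[|i0 fi0 h] : forall s : seq I, has (fun i => f i != 0) s ->
    exists2 i0, f i0 != 0 & forall i, i \in s -> exists z, f i = f i0 * val z.
- by apply/hasP; exists i; rewrite ?mem_enum.
- by exists i0 => // j; apply: h; rewrite mem_enum.
elim=> // a s IH /=; have [/IH[i0 fi0 h] _|nh /orP[fa|//]] := boolP (has _ s); last first.
  exists a => // j; rewrite inE => /predU1P[->|js]; first by exists 1; rewrite rmorph1 mulr1.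
  exists 0; rewrite rmorph0 mulr0; apply/eqP/negPn/negP => fj.
  by case/negP: nh; apply/hasP; exists j.
have [[z az]|[a0 [z az _]]] := pl_valuative pl (f a / f i0).
  exists i0 => // j; rewrite inE => /predU1P[->|/h//].
  by exists z; rewrite -az mulrCA divff ?mulr1.
have fa0 : f a != 0 by apply: contraNneq a0 => ->; rewrite mul0r.
have fi0E : f i0 = f a * val z by rewrite -az invf_div mulrCA divff // mulr1.
exists a => // j; rewrite inE => /predU1P[->|/h[y ->]]; first by exists 1; rewrite rmorph1 mulr1.
by exists (z * y); rewrite rmorphM mulrA -fi0E.
Qed.

Lemma integral_mx m n (M : 'M[K]_(m, n)) :
  (forall i j, integral (M i j)) -> exists N : 'M[R]_(m, n), M = map_mx val N.
Proof.
move=> h; have [f fE] := choice (fun ij : 'I_m * 'I_n => h ij.1 ij.2).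
by exists (\matrix_(i, j) f (i, j)); apply/matrixP => i j; rewrite !mxE (fE (i, j)).
Qed.

Lemma map_val_inj m n : injective (map_mx val : 'M[R]_(m, n) -> 'M[K]_(m, n)).
Proof.
move=> M N e; apply/matrixP => i j; apply: (pl_val_inj pl).
by have := congr1 (fun A : 'M_(m, n) => A i j) e; rewrite !mxE.
Qed.

Lemma map_res_cst m n (M : 'M[F]_(m, n)) : map_mx res (map_mx cst M) = M.
Proof. by apply/matrixP => i j; rewrite !mxE pl_cstK. Qed.

(** The matrix [g] and its contragredient [h] are divided by a common entry [c] of maximal
    valuation. Were [c] not integral, the quotients would satisfy [M i *m g' = h' *m B i] and
    [g'^T *m h'] = c^-2, and reduce to a pair excluded by [reduced_no_degeneration]. *)
Lemma integral_of_forms n (M : 'I_3 -> 'M[F]_n) (B : 'I_3 -> 'M[R]_n) (g : 'M[K]_n) :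
  (forall i, (M i)^T = M i) -> reduced (disc M) -> \det g = 1 ->
  (forall i, g^T *m map_mx val (map_mx cst (M i)) *m g = map_mx val (B i)) ->
  exists g', g = map_mx val g'.
Proof.
move=> symM redM g1 gMg; have [->|g0] := eqVneq g 0.
  by exists 0; rewrite map_mx0.
have gu : g \in unitmx by rewrite unitmxE g1 unitr1.
pose h := (invmx g)^T.
have Mg i : map_mx val (map_mx cst (M i)) *m g = h *m map_mx val (B i).
  by rewrite -gMg !mulmxA -[h *m g^T]trmx_mul mulmxV // trmx1 mul1mx.
have gh : g^T *m h = 1%:M by rewrite -trmx_mul mulVmx // trmx1.
(* The boolean selects [g] or [h], so that one entry dominates both matrices. *)
pose f (t : bool * ('I_n * 'I_n)) := (if t.1 then g else h) t.2.1 t.2.2.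
have [|t0 c0 fE] := @integral_max _ f.
  have [i [j gij]] : exists i j, g i j != 0.
    by apply: contrapT => nz; case/eqP: g0; apply/matrixP => i j; rewrite mxE;
      apply/eqP/negPn/negP => gij; apply: nz; exists i, j.
  by exists (true, (i, j)).
set c := f t0 in c0 fE.
have [q qE] := choice fE.
pose g' := \matrix_(i, j) q (true, (i, j)); pose h' := \matrix_(i, j) q (false, (i, j)).
have gE : g = c *: map_mx val g'.
  by apply/matrixP => i j; rewrite !mxE; exact: (qE (true, (i, j))).
have hE : h = c *: map_mx val h'.
  by apply/matrixP => i j; rewrite [RHS]mxE [X in _ * X]mxE [X in val X]mxE;
    exact: (qE (false, (i, j))).
have [[z cz]|[_ [y cy y0]]] := pl_valuative pl c.
  by exists (z *: g'); rewrite map_mxZ -cz.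
have Mg' i : map_mx cst (M i) *m g' = h' *m B i.
  apply: map_val_inj; rewrite !map_mxM /=; apply: (scalerI c0).
  by rewrite scalemxAr -gE Mg hE scalemxAl.
have ghE : g^T *m h = c ^+ 2 *: map_mx val (g'^T *m h').
  have gT : g^T = c *: map_mx val g'^T by rewrite {1}gE; apply/matrixP => i j; rewrite !mxE.
  by rewrite gT hE -scalemxAl -scalemxAr scalerA -expr2 map_mxM.
have gh' : g'^T *m h' = (y ^+ 2)%:M.
  apply: map_val_inj; apply: (scalerI (expf_neq0 2 c0)); rewrite -ghE gh.
  by rewrite map_scalar_mx /= rmorphXn /= -cy scale_scalar_mx -exprMn divff // expr1n.
(* As [g] has determinant 1, [B] keeps the discriminant of the net, and so does its reduction. *)
have discB : disc B = disc (fun i => map_mx cst (M i)).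
  exact: disc_conj1_map (pl_val_inj pl) g1 gMg.
have discrB : disc (fun i => map_mx res (B i)) = disc M.
  rewrite -(map_disc res B) discB (map_disc res).
  by apply: disc_ext => i; rewrite map_res_cst.
have [] := reduced_no_degeneration (g := map_mx res g') (h := map_mx res h') symM redM discrB.
- by move=> i; rewrite -map_mxM -Mg' map_mxM /= map_res_cst.
- by rewrite map_trmx -map_mxM gh' map_scalar_mx rmorphXn /= y0 expr0n raddf0.
(* The dominating entry divided by itself is 1, which does not reduce to 0. *)
move=> rg rh; have q1 : q t0 = 1.
  by apply: (pl_val_inj pl); rewrite rmorph1; apply: (mulfI c0); rewrite -qE mulr1.
suff : res (q t0) = 0 by rewrite q1 rmorph1 => /eqP; rewrite oner_eq0.
case: t0 => [[] [i j]] in c qE g' h' gE hE Mg' ghE gh' discrB rg rh {q1 c0 cy fE} *.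
  by have := congr1 (fun A : 'M_n => A i j) rg; rewrite !mxE.
by have := congr1 (fun A : 'M_n => A i j) rh; rewrite !mxE.
Qed.

(** Inverses are explicit because [R] carries no unit-ring structure. *)
Definition invertible n (a : 'M[R]_n) := exists2 a', a' *m a = 1%:M & a *m a' = 1%:M.

Lemma invertible1 n : invertible (1%:M : 'M[R]_n).
Proof. by exists 1%:M; rewrite mulmx1. Qed.

Lemma invertibleM n (a b : 'M[R]_n) : invertible a -> invertible b -> invertible (a *m b).
Proof.
move=> [a' a'a aa'] [b' b'b bb']; exists (b' *m a').
  by rewrite mulmxA -[b' *m a' *m a]mulmxA a'a mulmx1.
by rewrite mulmxA -[a *m b *m b']mulmxA bb' mulmx1.
Qed.

Lemma invertible_tperm n (i j : 'I_n) : invertible (tperm_mx i j).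
Proof.
by exists (tperm_mx i j); rewrite /tperm_mx -perm_mxM tperm2 perm_mx1.
Qed.

Lemma invertible_diag m n (a : 'M[R]_m) (b : 'M[R]_n) :
  invertible a -> invertible b -> invertible (block_mx a 0 0 b).
Proof.
move=> [a' a'a aa'] [b' b'b bb']; exists (block_mx a' 0 0 b').
  by rewrite mulmx_block !mul0mx !mulmx0 !addr0 !add0r a'a b'b -scalar_mx_block.
by rewrite mulmx_block !mul0mx !mulmx0 !addr0 !add0r aa' bb' -scalar_mx_block.
Qed.

Lemma invertible_lunip m n (v : 'M[R]_(n, m)) : invertible (block_mx 1%:M 0 v 1%:M).
Proof.
by exists (block_mx 1%:M 0 (- v) 1%:M);
  rewrite mulmx_block !mul0mx !mulmx0 !mul1mx !mulmx1 !addr0 !add0r ?addNr ?addrN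
          -scalar_mx_block.
Qed.

Lemma invertible_runip m n (v : 'M[R]_(m, n)) : invertible (block_mx 1%:M v 0 1%:M).
Proof.
by exists (block_mx 1%:M (- v) 0 1%:M);
  rewrite mulmx_block !mul0mx !mulmx0 !mul1mx !mulmx1 !addr0 !add0r ?addNr ?addrN
          -scalar_mx_block.
Qed.

(** An entry of maximal valuation divides all the others. Moved to the corner, it clears its row and
    column, and the induction applies to the Schur complement. *)
Lemma smith n (M : 'M[K]_n) : exists a b : 'M[R]_n, exists d,
  [/\ invertible a, invertible b & map_mx val a *m M *m map_mx val b = diag_mx d].
Proof.
elim: n M => [|n IH] M.
  exists 1%:M, 1%:M, 0; split; try exact: invertible1.
  by apply/matrixP => -[].
have [->|M0] := eqVneq M 0.
  exists 1%:M, 1%:M, 0; split; try exact: invertible1.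
  by rewrite mulmx0 mul0mx raddf0.
have [|[i0 j0] c0 /choice[q qE]] := @integral_max _ (fun ij => M ij.1 ij.2).
  apply: contrapT => nz; case/eqP: M0; apply/matrixP => i j; rewrite mxE.
  by apply/eqP/negPn/negP => Mij; apply: nz; exists (i, j).
rewrite /= in c0 qE; set c := M i0 j0 in c0 qE.
have MqE i j : M i j = c * val (q (i, j)) by exact: (qE (i, j)).
have q0 : q (i0, j0) = 1.
  by apply: (pl_val_inj pl); apply: (mulfI c0); rewrite -MqE rmorph1 mulr1.
pose Q : 'M[R]_(1 + n) := \matrix_(i, j) q (tperm ord0 i0 i, tperm ord0 j0 j).
pose P1 : 'M[R]_(1 + n) := tperm_mx ord0 i0.
pose P2 : 'M[R]_(1 + n) := tperm_mx ord0 j0.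
have PMP : map_mx val P1 *m M *m map_mx val P2 = c *: map_mx val Q.
  rewrite /P1 /P2 /tperm_mx !map_perm_mx -row_permE -[tperm ord0 j0]tpermV -col_permE.
  by apply/matrixP => i j; rewrite !mxE MqE.
have Q00 : ulsubmx Q = 1%:M.
  apply/matrixP => i j; rewrite !ord1 !mxE.
  have -> : lshift n (0 : 'I_1) = ord0 by apply: val_inj.
  by rewrite !tpermL q0.
pose v := dlsubmx Q; pose u := ursubmx Q; pose N := drsubmx Q.
have QE : Q = block_mx 1%:M u v N by rewrite -Q00 submxK.
have [a [b [d [ia ib dE]]]] := IH (c *: map_mx val (N - v *m u)).
pose L : 'M[R]_(1 + n) := block_mx 1%:M 0 (- v) 1%:M.
pose T : 'M[R]_(1 + n) := block_mx 1%:M (- u) 0 1%:M.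
have LQT : L *m Q *m T = block_mx 1%:M 0 0 (N - v *m u).
  rewrite QE !mulmx_block !mul0mx !mulmx0 !mul1mx !mulmx1 !addr0.
  by rewrite mul1mx !addNr mul0mx add0r mulNmx addrC.
pose a1 : 'M[R]_(1 + n) := block_mx 1%:M 0 0 a.
pose b1 : 'M[R]_(1 + n) := block_mx 1%:M 0 0 b.
exists (a1 *m (L *m P1)), (P2 *m T *m b1), (row_mx c%:M d); split.
- apply: invertibleM; last apply: invertibleM.
  + exact: (@invertible_diag 1 n _ _ (invertible1 1) ia).
  + exact: (@invertible_lunip 1 n (- v)).
  + exact: invertible_tperm.
- apply: invertibleM; first apply: invertibleM.
  + exact: invertible_tperm.
  + exact: (@invertible_runip 1 n (- u)).
  + exact: (@invertible_diag 1 n _ _ (invertible1 1) ib).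
rewrite !map_mxM -!mulmxA (mulmxA M) (mulmxA (map_mx val P1)) (mulmxA (map_mx val P1)) PMP.
rewrite (mulmxA (c *: _)) (mulmxA (map_mx val L)).
have -> : map_mx val L *m (c *: map_mx val Q *m map_mx val T) =
  c *: map_mx val (L *m Q *m T).
  by rewrite !map_mxM -scalemxAl -scalemxAr mulmxA.
have -> : diag_mx (row_mx c%:M d : 'rV_(1 + n)) = block_mx c%:M 0 0 (diag_mx d).
  rewrite diag_mx_row; congr block_mx.
  by apply/matrixP => i j; rewrite !ord1 !mxE.
have blk : map_mx val a1 *m (c *: map_mx val (L *m Q *m T) *m map_mx val b1) =
    block_mx c%:M 0 0 (diag_mx d).
  rewrite LQT /a1 /b1 !map_block_mx !map_mx1 !map_mx0 scale_block_mx !scaler0.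
  rewrite !mulmx_block !mul0mx !mulmx0 !mul1mx !mulmx1 !addr0 !add0r.
  by rewrite mulmxA dE scale_scalar_mx mulr1 mulmx0.
exact: blk.
Qed.

End Integrality.

(** * Linear combinations of the members of a net *)

Section Combinations.

Definition comb (S : pzRingType) m n (t : 'M[S]_3) (M : 'I_3 -> 'M[S]_(m, n)) :
  'I_3 -> 'M[S]_(m, n) := fun i => \sum_j t i j *: M j.

(** The indices are transposed because, in the pencil of [comb t M], the coefficient of [M j] is the
    sum over r of [t r j] times X_r. *)
Definition lin (S : nzRingType) (t : 'M[S]_3) : 3.-tuple {mpoly S[3]} :=
  [tuple \sum_(j < 3) t j i *: 'X_j | i < 3].

Lemma comb_ext (S : pzRingType) m n t (M N : 'I_3 -> 'M[S]_(m, n)) :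
  M =1 N -> comb t M =1 comb t N.
Proof. by move=> e i; apply: eq_bigr => j _; rewrite e. Qed.

Lemma comb_mul (S : pzRingType) m n s t (M : 'I_3 -> 'M[S]_(m, n)) :
  comb (s *m t) M =1 comb s (comb t M).
Proof.
move=> i; rewrite /comb; under [RHS]eq_bigr do rewrite scaler_sumr.
rewrite exchange_big /=; apply: eq_bigr => j _; rewrite mxE scaler_suml.
by apply: eq_bigr => k _; rewrite scalerA.
Qed.

Lemma comb1 (S : pzRingType) m n (M : 'I_3 -> 'M[S]_(m, n)) : comb 1%:M M =1 M.
Proof.
move=> i; rewrite /comb (bigD1 i) //= big1 => [|j ji]; first by rewrite mxE eqxx scale1r addr0.
by rewrite mxE eq_sym (negPf ji) scale0r.
Qed.

Lemma map_comb (S T : pzRingType) (f : {rmorphism S -> T}) m n t (M : 'I_3 -> 'M[S]_(m, n)) i :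
  map_mx f (comb t M i) = comb (map_mx f t) (fun j => map_mx f (M j)) i.
Proof.
apply/matrixP => a b; rewrite mxE !summxE rmorph_sum; apply: eq_bigr => j _.
by rewrite !mxE rmorphM.
Qed.

Lemma comb_conj (S : comPzRingType) m n (t : 'M[S]_3) (g : 'M[S]_(m, n)) M i :
  comb t (fun j => g^T *m M j *m g) i = g^T *m comb t M i *m g.
Proof.
rewrite /comb mulmx_sumr mulmx_suml; apply: eq_bigr => j _.
by rewrite -scalemxAr -scalemxAl.
Qed.

Lemma disc_comb (S : comNzRingType) n t (M : 'I_3 -> 'M[S]_n) :
  disc (comb t M) = disc M \mPo lin t.
Proof.
rewrite !discE -[RHS]det_map_mx; congr (\det _); apply/matrixP => a b.
rewrite !pencilE !mxE !summxE [RHS]rmorph_sum.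
transitivity (\sum_r \sum_j t r j *: ('X_r * (M j a b)%:MP) : {mpoly S[3]}).
  apply: eq_bigr => r _; rewrite !mxE summxE rmorph_sum mulr_sumr.
  by apply: eq_bigr => j _; rewrite !mxE /= mpolyCM mulrCA mul_mpolyC.
rewrite exchange_big; apply: eq_bigr => j _.
rewrite !mxE [RHS]rmorphM /= comp_mpolyXU comp_mpolyC -tnth_nth tnth_mktuple mulr_suml.
by apply: eq_bigr => r _; rewrite scalerAl.
Qed.

Lemma act_form_lin (F : fieldType) (g : 'M[F]_3) f : act_form g f = f \mPo lin (invmx g)^T.
Proof.
congr (_ \mPo _); apply: eq_from_tnth => i; rewrite !tnth_mktuple.
by apply: eq_bigr => j _; rewrite mxE.
Qed.

Lemma mcoeff_lin_diag (S : comNzRingType) (d : 'rV[S]_3) (p : {mpoly S[3]}) m :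
  (p \mPo lin (diag_mx d))@_m = p@_m * \prod_i d 0 i ^+ m i.
Proof.
have linE i : tnth (lin (diag_mx d)) i = d 0 i *: 'X_i.
  rewrite tnth_mktuple (bigD1 i) //= big1 => [|j ji]; first by rewrite mxE eqxx addr0.
  by rewrite mxE (negPf ji) scale0r.
rewrite comp_mpolyE raddf_sum /=.
transitivity (\sum_(k <- msupp p) p@_k * \prod_i d 0 i ^+ k i * (k == m)%:R).
  apply: eq_bigr => k _; rewrite mcoeffZ -mulrA; congr (_ * _).
  under eq_bigr do rewrite linE exprZn.
  by rewrite scaler_prod -mpolyXE_id mcoeffZ mcoeffX.
have [mp|mp] := boolP (m \in msupp p).
  rewrite (bigD1_seq m) ?msupp_uniq //= eqxx mulr1 [X in _ + X]big1 ?addr0 // => k km.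
  by rewrite (negPf km) mulr0.
rewrite (memN_msupp_eq0 mp) mul0r big_seq [LHS]big1 // => k kp.
have [km|_] := eqVneq k m; last by rewrite mulr0.
by rewrite -km kp in mp.
Qed.

Lemma dhomog_bigprod (S : comNzRingType) (I : finType) (f : I -> {mpoly S[3]}) :
  (forall i, f i \is 1.-homog) -> \prod_i f i \is #|I|.-homog.
Proof.
move=> hf; have -> : #|I| = size (index_enum I) by rewrite cardT enumT.
elim: (index_enum I) => [|i r IH]; first by rewrite big_nil dhomog1.
by rewrite big_cons; apply: (@dhomogM _ _ _ 1 _ (size r)).
Qed.

Lemma disc_homog (S : comNzRingType) n (M : 'I_3 -> 'M[S]_n) : disc M \is n.-homog.
Proof.
rewrite discE; apply: rpred_sum => s _; rewrite -signr_odd.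
have h : \prod_i pencil M i (s i) \is n.-homog.
  rewrite -[X in X.-homog]card_ord; apply: dhomog_bigprod => i.
  rewrite pencilE summxE; apply: rpred_sum => r _.
  rewrite !mxE mulrC mul_mpolyC; apply: rpredZ.
  by rewrite dhomogX; apply/eqP; exact: mdeg1.
by case: odd; rewrite ?expr1 ?expr0 ?mulN1r ?mul1r ?rpredN.
Qed.

End Combinations.

(** * One-parameter subgroups *)

Section Torus.
Variable F : closedFieldType.

Lemma power_avoids (n : nat) (V : seq F) : (0 < n)%N -> exists2 t : F, t != 0 & t ^+ n \notin V.
Proof.
move=> n0; pose p : {poly F} := 'X * \prod_(a <- V) ('X^n - a%:P).
have p0 : p != 0.
  rewrite mulf_neq0 ?polyX_eq0 // prodf_seq_neq0; apply/allP => a _ /=.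
  by rewrite -size_poly_eq0 size_XnsubC.
have /closed_nonrootP[t] := p0; rewrite rootE hornerM hornerX mulf_eq0 negb_or.
move=> /andP[t0 pt]; exists t => //; apply: contra pt => tV.
rewrite horner_prod (big_rem _ tV) /= hornerD hornerN hornerXn hornerC subrr mul0r.
by [].
Qed.

Lemma zpower_avoids (k : int) (V : seq F) : k != 0 -> exists2 t : F, t != 0 & t ^ k \notin V.
Proof.
move=> k0; have n0 : (0 < `|k|)%N by rewrite absz_gt0.
(* The inverses are added for the case of negative [k]. *)
have [t t0 tV] := power_avoids (V ++ [seq a^-1 | a <- V]) n0.
exists t => //; move: tV; rewrite mem_cat negb_or => /andP[tV tV'].
case: k k0 n0 tV tV' => k k0 n0 tV tV'; first exact: tV.
rewrite NegzE -exprnN; apply: contra tV' => tV'.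
by apply/mapP; exists ((t ^+ k.+1)^-1); rewrite ?invrK.
Qed.

(** The value at [t] of the one-parameter subgroup with weights [r]. *)
Definition torus (t : F) (r : 'I_3 -> int) : 'M[F]_3 := diag_mx (\row_i t ^ r i).

Lemma torus_avoids (r : 'I_3 -> int) (l : seq 'M[F]_3) :
  (exists i, r i != 0) -> exists2 t : F, t != 0 & torus t r \notin l.
Proof.
move=> [i ri]; have [t t0 tV] := zpower_avoids [seq m i i | m : 'M[F]_3 <- l] ri.
exists t => //; apply: contra tV => tl; apply/mapP; exists (torus t r) => //.
by rewrite !mxE eqxx.
Qed.

Lemma prod_exprz (t : F) (I : finType) (r : I -> int) : t != 0 ->
  \prod_i t ^ r i = t ^ (\sum_i r i).
Proof.
move=> t0; elim/big_rec2: _ => [|i a b _ ->]; first by rewrite expr0z.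
by rewrite expfzDr.
Qed.

Lemma det_torus t r : t != 0 -> \sum_i r i = 0 -> \det (torus t r) = 1.
Proof.
move=> t0 r0; rewrite det_diag; under eq_bigr do rewrite mxE.
by rewrite prod_exprz // r0 expr0z.
Qed.

Lemma torus_stabilizes n (N : 'I_3 -> 'M[F]_n) t r : t != 0 ->
  (forall m, (disc N)@_m != 0 -> \sum_i (m i)%:Z * r i = 0) ->
  disc (comb (torus t r) N) = disc N.
Proof.
move=> t0 h; rewrite disc_comb; apply/mpolyP => m; rewrite mcoeff_lin_diag.
have [->|/h hm] := eqVneq (disc N)@_m 0; first by rewrite mul0r.
under eq_bigr => i _ do rewrite mxE exprnP exprz_exp mulrC.
by rewrite prod_exprz // hm expr0z mulr1.
Qed.

Definition finite_stabilizer n (N : 'I_3 -> 'M[F]_n) :=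
  exists l : seq 'M[F]_3, forall s, \det s = 1 -> disc (comb s N) = disc N -> s \in l.

(** Stabilizers along an orbit are conjugate. *)
Lemma finite_stabilizer_comb n (N : 'I_3 -> 'M[F]_n) u : \det u = 1 ->
  finite_stabilizer N -> finite_stabilizer (comb u N).
Proof.
move=> u1 [l lN]; exists [seq u *m s *m invmx u | s <- l] => s s1 e.
have uu : u \in unitmx by rewrite unitmxE u1 unitr1.
have uV1 : \det (invmx u) = 1 by rewrite det_inv u1 invr1.
apply/mapP; exists (invmx u *m s *m u); last first.
  by rewrite !mulmxA mulmxV // mul1mx -mulmxA mulmxV // mulmx1.
apply: lN; first by rewrite !det_mulmx u1 s1 uV1 !mulr1.
rewrite -mulmxA (disc_ext (comb_mul _ _ _)) disc_comb (disc_ext (comb_mul _ _ _)) e.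
by rewrite -disc_comb -(disc_ext (comb_mul _ _ _)) mulVmx // (disc_ext (comb1 _)).
Qed.

(** If all monomials of the form have weight 0, the one-parameter subgroup fixes it, and a
    nontrivial one-parameter subgroup escapes every finite list. *)
Lemma no_torus_stabilizer n (N : 'I_3 -> 'M[F]_n) (r : 'I_3 -> int) :
  finite_stabilizer N -> (exists i, r i != 0) -> \sum_i r i = 0 ->
  (forall m, (disc N)@_m != 0 -> \sum_i (m i)%:Z * r i = 0) -> False.
Proof.
move=> [l lN] hr r0 h; have [t t0 tl] := torus_avoids l hr; case/negP: tl.
by apply: lN; [exact: det_torus|exact: torus_stabilizes].
Qed.
End Torus.

(** * Units of the valuation ring and weights *)

Section Weights.
Variables (F : fieldType) (X : pointedType) (pl : place F X).
Local Notation K := (pl_field pl).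
Local Notation R := (pl_ring pl).
Local Notation val := (pl_val pl).
Local Notation res := (pl_res pl).
Local Notation cst := (pl_cst pl).

Definition unital (x : K) := exists2 u : R, x = val u & res u != 0.

Lemma unital_neq0 x : unital x -> x != 0.
Proof.
move=> [u -> u0]; apply: contra u0 => /eqP; rewrite -(rmorph0 val) => /(pl_val_inj pl) ->.
by rewrite rmorph0.
Qed.

Lemma unitalM x y : unital x -> unital y -> unital (x * y).
Proof.
by move=> [u -> u0] [v -> v0]; exists (u * v); rewrite ?rmorphM ?mulf_neq0.
Qed.

Lemma unitalV x : unital x -> unital x^-1.
Proof.
move=> ux; have x0 := unital_neq0 ux; case: ux => u xu u0.
have [[z xz]|[_ [z xz z0]]] := pl_valuative pl x^-1; last first.
  case/negP: u0; suff -> : u = z by rewrite z0.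
  by apply: (pl_val_inj pl); rewrite -xu -xz invrK.
exists z => //; have /(congr1 res) : z * u = 1.
  by apply: (pl_val_inj pl); rewrite rmorphM rmorph1 /= -xz -xu mulVf.
rewrite rmorphM rmorph1 => e; apply: contra_eq_neq e => -> /=.
by rewrite mul0r eq_sym oner_neq0.
Qed.

Lemma unitalX x n : unital x -> unital (x ^+ n).
Proof.
move=> ux; elim: n => [|n IH]; last by rewrite exprS; exact: unitalM.
by exists 1; rewrite ?rmorph1 ?oner_neq0.
Qed.

Lemma unitalXz x (k : int) : unital x -> unital (x ^ k).
Proof.
move=> ux; case: k => n; first exact: unitalX.
by rewrite NegzE -exprnN; apply/unitalV/unitalX.
Qed.

Lemma unital_rootn x n : (0 < n)%N -> unital (x ^+ n) -> unital x.
Proof.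
move=> n0 [u xu u0]; have [[z xz]|[x0 [z xz z0]]] := pl_valuative pl x.
  exists z => //; apply: contra u0 => /eqP z0.
  have -> : u = z ^+ n by apply: (pl_val_inj pl); rewrite rmorphXn /= -xz.
  by rewrite rmorphXn /= z0 expr0n gtn_eqF.
have /(congr1 res)/eqP : u * z ^+ n = 1.
  apply: (pl_val_inj pl); rewrite rmorphM rmorphXn rmorph1 /= -xz -xu.
  by rewrite -exprMn divff // expr1n.
by rewrite rmorphM rmorphXn /= z0 expr0n gtn_eqF // mulr0 rmorph1 eq_sym oner_eq0.
Qed.

Lemma unital_root x (k : int) : k != 0 -> unital (x ^ k) -> unital x.
Proof.
case: k => [n k0|n _]; first by apply: unital_rootn; rewrite lt0n.
rewrite NegzE -exprnN => /unitalV; rewrite invrK; exact: unital_rootn.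
Qed.

Lemma unital_integral x : unital x -> integral x.
Proof. by move=> [u -> _]; exists u. Qed.

(* The exponents m with [prod_i d_i ^ m_i] unital form a saturated subgroup of
   Z^3 containing (1, 1, 1); when it is not all of Z^3, it lies in the kernel of
   a nonzero integral linear form. *)
Lemma unital_weights (d : 'I_3 -> K) : \prod_i d i = 1 ->
  (forall i, integral (d i)) \/
  exists r : 'I_3 -> int, [/\ exists i, r i != 0, \sum_i r i = 0 &
    forall m : 'X_{1..3}, unital (\prod_i d i ^+ m i) -> \sum_i (m i)%:Z * r i = 0].
Proof.
set i0 : 'I_3 := 0; set i1 : 'I_3 := 1; set i2 : 'I_3 := 2%:R.
have prod3 (T : comPzRingType) (f : 'I_3 -> T) : \prod_i f i = f i0 * f i1 * f i2.
  rewrite !big_ord_recl big_ord0 mulr1 mulrA.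
  by congr (f _ * f _ * f _); apply: val_inj.
have sum3 (f : 'I_3 -> int) : \sum_i f i = f i0 + f i1 + f i2.
  rewrite !big_ord_recl big_ord0 addr0 addrA.
  by congr (f _ + f _ + f _); apply: val_inj.
rewrite prod3 => d1.
have d01 : d i0 * d i1 != 0.
  by apply/eqP => e; move/eqP: d1; rewrite e mul0r eq_sym oner_eq0.
have /norP[d0n d1n] : ~~ ((d i0 == 0) || (d i1 == 0)) by rewrite -mulf_eq0.
have d2E : d i2 = (d i0 * d i1)^-1 by rewrite -[RHS]mulr1 -d1 mulKf.
(* Eliminating [d i2] by the product condition leaves the exponents ([p m], [q m]) of [d i0] and
   [d i1]. *)
pose p (m : 'X_{1..3}) : int := (m i0)%:Z - (m i2)%:Z.
pose q (m : 'X_{1..3}) : int := (m i1)%:Z - (m i2)%:Z.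
have mE (m : 'X_{1..3}) : \prod_i d i ^+ m i = d i0 ^ p m * d i1 ^ q m.
  rewrite prod3 d2E exprVn exprMn !exprnP invfM !expfzDr // -!exprnN.
  by rewrite mulrACA mulrA.
have [[m [um nz]]|nm] := EM (exists m : 'X_{1..3},
    unital (\prod_i d i ^+ m i) /\ (p m, q m) != (0, 0)); last first.
  (* All unital exponents are multiples of (1, 1, 1) here, so any nonzero weights of sum 0 will
     do. *)
  right; exists (fun i => if i == i0 then 1 else if i == i1 then -1 else 0); split.
  - by exists i0.
  - by rewrite sum3.
  - move=> m um; rewrite sum3 /= mulr1 mulrN1 mulr0 addr0.
    have [e|e] := eqVneq (p m, q m) (0, 0); last by case: nm; exists m.
    case: e => /eqP; rewrite subr_eq0 => /eqP -> /eqP; rewrite subr_eq0 => /eqP ->.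
    by rewrite subrr.
(* Two independent unital exponents: by Cramer's rule the powers of [d i0] and [d i1] by the
   determinant are unital, hence so are [d i0] and [d i1]. *)
have [[m' [um' D0]]|nD] :=
    EM (exists m' : 'X_{1..3}, unital (\prod_i d i ^+ m' i) /\ p m * q m' - p m' * q m != 0).
  left; rewrite !mE in um um'.
  have u0 : unital (d i0).
    apply: (unital_root D0).
    have -> : d i0 ^ (p m * q m' - p m' * q m) =
        (d i0 ^ p m * d i1 ^ q m) ^ q m' * (d i0 ^ p m' * d i1 ^ q m') ^ (- q m).
      rewrite !expfzMl !exprz_exp mulrACA -!expfzDr //.
      by rewrite mulrN -[q m * q m']mulrC mulrN subrr expr0z mulr1.
    by apply: unitalM; exact: unitalXz.
  have u1 : unital (d i1).
    apply: (unital_root D0).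
    have -> : d i1 ^ (p m * q m' - p m' * q m) =
        (d i0 ^ p m' * d i1 ^ q m') ^ (p m) * (d i0 ^ p m * d i1 ^ q m) ^ (- p m').
      rewrite !expfzMl !exprz_exp mulrACA -!expfzDr //.
      by rewrite mulrN [p m' * p m]mulrC subrr expr0z mul1r mulrN [q m' * _]mulrC [q m * _]mulrC.
    by apply: unitalM; exact: unitalXz.
  move=> i; apply: unital_integral; case: i => -[|[|[|//]]] lt_i.
  - by rewrite (_ : Ordinal _ = i0) //; apply: val_inj.
  - by rewrite (_ : Ordinal _ = i1) //; apply: val_inj.
  - rewrite (_ : Ordinal _ = i2); last exact: val_inj.
    by rewrite d2E; apply/unitalV/unitalM.
(* These weights are the cross product of [m] and (1, 1, 1). *)
right; exists (fun i => if i == i0 then q m else if i == i1 then - p m else p m - q m); split.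
- apply: contrapT => z; case/negP: nz; apply/eqP; congr (_, _).
    by apply/eqP/negPn/negP => pm; apply: z; exists i1; rewrite /= oppr_eq0.
  by apply/eqP/negPn/negP => qm; apply: z; exists i0.
- by rewrite sum3 /= addrA subrK subrr.
- move=> m' um'; rewrite sum3 /=.
  have /eqP : p m * q m' - p m' * q m = 0.
    by apply/eqP/negPn/negP => D0; apply: nD; exists m'.
  move/eqP=> e; rewrite -[RHS]oppr0 -e; move: (p m) (q m) => a b; rewrite /p /q; ring.
Qed.
End Weights.

(** * Integrality from the stability of the sextic *)

Section HilbertMumford.
Variables (F : fieldType) (X : pointedType) (pl : place F X).
Local Notation K := (pl_field pl).
Local Notation R := (pl_ring pl).
Local Notation cls := (pl_class pl).
Local Notation val := (pl_val pl).
Local Notation res := (pl_res pl).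
Local Notation cst := (pl_cst pl).

Lemma polyfun_place (I : finType) (P : vec F I -> F) (z : I -> R) (w : X -> vec F I) :
  polyfun P -> (forall i, val (z i) = cls (fun x => w x i)) ->
  exists2 y, val y = cls (fun x => P (w x)) & res y = P [ffun i => res (z i)].
Proof.
move=> PP zE; elim: PP => [a|i|f g _ [y yE yf] _ [y' yE' yg]|f g _ [y yE yf] _ [y' yE' yg]].
- by exists (cst a); rewrite ?pl_val_cst ?pl_cstK.
- by exists (z i); rewrite ?ffunE.
- by exists (y + y'); [rewrite rmorphD yE yE' -rmorphD | rewrite rmorphD yf yg].
- by exists (y * y'); [rewrite rmorphM /= yE yE' -rmorphM | rewrite rmorphM /= yf yg].
Qed.

(** Polynomials vanishing on [S] vanish at the moving point, hence at its reduction. *)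
Lemma closed_place (I : finType) (S : vec F I -> Prop) (z : I -> R) (w : X -> vec F I) :
  zariski_closed S -> (forall i, val (z i) = cls (fun x => w x i)) ->
  (forall x, S (w x)) -> S [ffun i => res (z i)].
Proof.
move=> clS zE wS; apply: contrapT => /clS[P [PP PS nP]]; apply: nP.
have [y yE <-] := polyfun_place PP zE.
suff -> : y = 0 by rewrite rmorph0.
apply: (pl_val_inj pl); rewrite yE rmorph0 -(rmorph0 cls); congr (cls _).
by apply/funext => x; exact: PS.
Qed.

(** In the decomposition of [smith], rescaling one row of [a] and one column of [b] corrects the
    determinants and keeps the product diagonal. *)
Lemma smith_SL n (M : 'M[K]_n.+1) : \det M = 1 ->
  exists a b : 'M[R]_n.+1, exists d,
  [/\ \det a = 1, \det b = 1 & map_mx val a *m M *m map_mx val b = diag_mx d].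
Proof.
move=> M1; have [a [b [d [[a' a'a _] [b' b'b _] abE]]]] := smith M.
pose E (u : R) : 'rV[R]_n.+1 := \row_i (if i == 0 then u else 1).
have detE u : \det (diag_mx (E u)) = u.
  rewrite det_diag big_ord_recl big1 ?mulr1; first by rewrite mxE eqxx.
  by move=> i _; rewrite mxE.
have inv_det (p q : 'M[R]_n.+1) : p *m q = 1%:M -> \det p * \det q = 1.
  by move=> e; rewrite -det_mulmx e det1.
exists (diag_mx (E (\det a')) *m a), (b *m diag_mx (E (\det b'))).
exists (\row_i (val (E (\det a') 0 i) * d 0 i * val (E (\det b') 0 i))); split.
- by rewrite det_mulmx detE inv_det.
- by rewrite det_mulmx detE mulrC inv_det.
- transitivity (map_mx val (diag_mx (E (\det a'))) *m diag_mx d *m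
                map_mx val (diag_mx (E (\det b')))).
    by rewrite -abE !map_mxM !mulmxA.
  rewrite !map_diag_mx !mulmx_diag; congr diag_mx.
  by apply/rowP => i; rewrite !mxE.
Qed.

Lemma SL_adj (S : comPzRingType) n (a : 'M[S]_n) : \det a = 1 ->
  [/\ a *m \adj a = 1%:M, \adj a *m a = 1%:M & \det (\adj a) = 1].
Proof.
move=> a1; have e1 : a *m \adj a = 1%:M by rewrite mul_mx_adj a1.
split=> //; first by rewrite mul_adj_mx a1.
by have := congr1 determinant e1; rewrite det_mulmx a1 mul1r det1.
Qed.

(** By [smith_SL] only the diagonal factor [d] of [t] has to be shown integral. The closed orbit
    contains a limit sextic, and d^m is unital for each of its monomials m; if [d] were not
    integral, [unital_weights] would give the weights forbidden by the second hypothesis. *)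
Lemma integral_of_sextic (M : 'I_3 -> 'M[F]_6) (t : 'M[K]_3) (g : 'M[K]_6) (T : 'I_3 -> 'M[R]_6) :
  zariski_closed (fun w : vec F _ =>
    exists2 s, \det s = 1 & w = coeffs6 (disc (comb s M))) ->
  (forall s (r : 'I_3 -> int), \det s = 1 -> (exists i, r i != 0) -> \sum_i r i = 0 ->
    (forall m, (disc (comb s M))@_m != 0 -> \sum_i (m i)%:Z * r i = 0) -> False) ->
  \det t = 1 -> \det g = 1 ->
  (forall i, comb t (fun j => g^T *m map_mx val (map_mx cst (M j)) *m g) i = map_mx val (T i)) ->
  exists t', t = map_mx val t'.
Proof.
move=> clM finM t1 g1 tT.
have [a [b [d [a1 b1 abE]]]] := smith_SL t1.
have [aa' a'a a'1] := SL_adj a1; have [bb' b'b b'1] := SL_adj b1.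
set a' := \adj a in aa' a'a a'1; set b' := \adj b in bb' b'b b'1.
have d1 : \prod_i d 0 i = 1.
  by rewrite -det_diag -abE !det_mulmx t1 !det_map_mx a1 b1 !rmorph1 !mulr1.
have atE : map_mx val a *m t = diag_mx d *m map_mx val b'.
  by rewrite -abE -mulmxA -map_mxM bb' map_mx1 mulmx1.
pose N := comb b' (fun j => map_mx cst (M j)).
pose Nb := comb (map_mx res b') M.
have NbE : map_mpoly res (disc N) = disc Nb.
  rewrite (map_disc res); apply: disc_ext => i; rewrite map_comb.
  by apply: comb_ext => j; rewrite map_res_cst.
(* Both sides are coefficients of one sextic: [a] times [t] is [d] times [b'], and the conjugation
   by [g] preserves discriminants. *)
have key m : val (disc N)@_m * \prod_i d 0 i ^+ m i = val (disc (comb a T))@_m.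
  have e : comb (diag_mx d) (fun i => map_mx val (N i)) =1
           comb (diag_mx d *m map_mx val b') (fun j => map_mx val (map_mx cst (M j))).
    move=> i; rewrite comb_mul; apply: comb_ext => k; exact: map_comb.
  rewrite -2!mcoeff_map_mpoly -mcoeff_lin_diag (map_disc val N) -disc_comb.
  rewrite (map_disc val (comb a T)) (disc_ext e) -(disc_conj1 _ g1).
  congr (_@_m); apply: disc_ext => i.
  rewrite -comb_conj -atE comb_mul map_comb; apply: comb_ext => j; exact: tT.
have int_d m : (disc Nb)@_m != 0 -> integral (\prod_i d 0 i ^+ m i).
  rewrite -NbE mcoeff_map_mpoly => /integral_unit_factor; apply.
  by rewrite key; exists (disc (comb a T))@_m.
(* The coefficients of the sextic [disc Nb] transformed by [d], as elements of [R]. *)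
have [|z zE] := choice (_ : forall m : 'X_{1..3 < 7}, exists z,
    val z = val (cst (disc Nb)@_m) * \prod_i d 0 i ^+ m i).
  move=> m; have [e|/int_d[y ->]] := eqVneq (disc Nb)@_m 0.
    by exists 0; rewrite e !rmorph0 mul0r.
  by exists (cst (disc Nb)@_m * y); rewrite rmorphM.
set i0 : 'I_3 := 0; set i1 : 'I_3 := 1; set i2 : 'I_3 := 2%:R.
have prod3 (S : comPzRingType) (f : 'I_3 -> S) : \prod_i f i = f i0 * f i1 * f i2.
  rewrite !big_ord_recl big_ord0 mulr1 mulrA.
  by congr (f _ * f _ * f _); apply: val_inj.
have dd := d1; rewrite prod3 in dd.
have d01 : d 0 i0 * d 0 i1 != 0.
  by apply/eqP => e; move/eqP: dd; rewrite e mul0r eq_sym oner_eq0.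
have /norP[d0n d1n] : ~~ ((d 0 i0 == 0) || (d 0 i1 == 0)) by rewrite -mulf_eq0.
have [f0 f0n f0E] := pl_nonzero_lift pl _ d0n.
have [f1 f1n f1E] := pl_nonzero_lift pl _ d1n.
(* The third function is defined as an inverse so that the product is 1 at every point, not just
   almost everywhere. *)
pose f (i : 'I_3) : X -> F := if i == i0 then f0 else if i == i1 then f1
  else fun x => (f0 x * f1 x)^-1.
have prodf x : \prod_i f i x = 1.
  by rewrite prod3 /f /= divff // mulf_neq0.
have fE i : cls (f i) = d 0 i.
  case: i => -[|[|[|//]]] lt_i.
  - by rewrite (_ : Ordinal _ = i0) //; apply: val_inj.
  - by rewrite (_ : Ordinal _ = i1) //; apply: val_inj.
  - rewrite (_ : Ordinal _ = i2); last exact: val_inj.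
    apply: (mulfI d01); rewrite dd /f /= -f0E -f1E -!rmorphM -(rmorph1 cls).
    congr (cls _); apply/funext => x; rewrite !mulrfctE divff //.
    by rewrite mulf_neq0.
(* A family inside the orbit, with generic point [z]; closedness puts the reduction of [z] in the
   orbit. *)
pose w x : vec F _ := coeffs6 (disc (comb (diag_mx (\row_i f i x) *m map_mx res b') M)).
have wE m : val (z m) = cls (fun x => w x m).
  rewrite zE pl_val_cst; under eq_bigr do rewrite -fE -rmorphXn.
  rewrite -rmorph_prod -rmorphM; congr (cls _); apply/funext => x.
  rewrite /w ffunE (disc_ext (comb_mul _ _ _)) disc_comb mcoeff_lin_diag.
  rewrite fct_prodE mulrfctE; congr (_ * _); apply: eq_bigr => i _.
  by rewrite exprfctE mxE.
have [|s s1 sE] := closed_place clM wE.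
  move=> x; exists (diag_mx (\row_i f i x) *m map_mx res b') => //.
  rewrite det_mulmx det_map_mx b'1 rmorph1 mulr1 det_diag -[RHS](prodf x).
  by apply: eq_bigr => i _; rewrite mxE.
have [int_di|[r [r0 sr rE]]] := unital_weights d1; last first.
  case: (finM s r s1 r0 sr) => m; rewrite -/i0 => nz; apply: rE.
  (* [coeffs6] records degrees below 7 only; a sextic has no other coefficients. *)
  have m6 : (mdeg m < 7)%N.
    rewrite ltnNge; apply: contra nz => m7; apply/eqP.
    by apply: (dhomog_nemf_coeff (disc_homog _)); rewrite neq_ltn m7 orbT.
  have := congr1 (fun v : vec F _ => v (BMultinom m6)) sE; rewrite !ffunE /= => zm.
  rewrite -zm in nz; have zmE := zE (BMultinom m6); rewrite /= in zmE.
  have n0 : (disc Nb)@_m != 0.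
    apply: contra nz => /eqP e; rewrite e !rmorph0 mul0r -(rmorph0 val) in zmE.
    by rewrite (pl_val_inj pl _ _ zmE) rmorph0.
  have [y yE] := int_d m n0; exists y => //.
  rewrite yE -rmorphM in zmE; rewrite (pl_val_inj pl _ _ zmE) rmorphM mulf_eq0 in nz.
  by case/norP: nz.
have [|d' d'E] := @integral_mx _ _ pl _ _ d; first by move=> i j; rewrite ord1; exact: int_di.
exists (a' *m diag_mx d' *m b'); rewrite !map_mxM map_diag_mx /= -d'E -mulmxA -atE.
by rewrite mulmxA -map_mxM a'a map_mx1 mul1mx.
Qed.
End HilbertMumford.

(** * Pluecker coordinates *)

Section Plucker.

Definition pl_column (t : pl_index) (s : 'I_3) : windex :=
  if s == 0 :> nat then t.1.1 else if s == 1 :> nat then t.1.2 else t.2.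

Definition minor (S : comPzRingType) (M : 'I_3 -> 'M[S]_6) (t : pl_index) : 'M[S]_3 :=
  \matrix_(r, s) M r (pl_column t s).1 (pl_column t s).2.

Definition plk (S : comPzRingType) (M : 'I_3 -> 'M[S]_6) t := \det (minor M t).

Definition triple (T : Type) (A1 A2 A3 : T) : 'I_3 -> T :=
  fun r => if r == 0 :> nat then A1 else if r == 1 :> nat then A2 else A3.

Lemma pluckerE (F : fieldType) (A1 A2 A3 : 'M[F]_6) t :
  plucker A1 A2 A3 t = plk (triple A1 A2 A3) t.
Proof. by rewrite ffunE; congr (\det _); apply/matrixP => r s; rewrite !mxE. Qed.

Lemma map_plk (S T : comPzRingType) (f : {rmorphism S -> T}) (M : 'I_3 -> 'M[S]_6) t :
  f (plk M t) = plk (fun i => map_mx f (M i)) t.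
Proof.
rewrite /plk -det_map_mx; congr (\det _); apply/matrixP => r s; by rewrite !mxE.
Qed.

Lemma plk_ext (S : comPzRingType) (M N : 'I_3 -> 'M[S]_6) t : M =1 N -> plk M t = plk N t.
Proof. by move=> e; congr (\det _); apply/matrixP => r s; rewrite !mxE e. Qed.

Definition pl_replace (t : pl_index) (r : 'I_3) (c : windex) : pl_index :=
  (if r == 0 :> nat then c else t.1.1, if r == 1 :> nat then c else t.1.2,
   if r == 2 :> nat then c else t.2).

Lemma pl_column_replace t r c s :
  pl_column (pl_replace t r c) s = if s == r then c else pl_column t s.
Proof.
by case: r => -[|[|[|//]]] ?; case: s => -[|[|[|//]]] ?.
Qed.

(** Cramer's rule: after multiplication by the adjugate of a minor, the entries of the net are
    themselves Pluecker coordinates. *)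
Lemma plk_replace (S : comPzRingType) (M : 'I_3 -> 'M[S]_6) t r c :
  plk M (pl_replace t r c) = \sum_k \adj (minor M t) r k * M k c.1 c.2.
Proof.
rewrite /plk (expand_det_col _ r); apply: eq_bigr => k _; rewrite mulrC !mxE.
rewrite pl_column_replace eqxx; congr (_ * _); congr (_ * \det _).
apply/matrixP => i j; rewrite !mxE pl_column_replace.
by rewrite eq_sym (negPf (neq_lift _ _)).
Qed.

Lemma plk_free (F : fieldType) (M : 'I_3 -> 'M[F]_6) t (c : 'I_3 -> F) :
  plk M t != 0 -> \sum_i c i *: M i = 0 -> forall i, c i = 0.
Proof.
move=> Mt cM i; have Nu : minor M t \in unitmx by rewrite unitmxE unitfE.
have : (\row_i c i) *m minor M t = 0.
  apply/rowP => s; rewrite !mxE.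
  have := congr1 (fun A : 'M_6 => A (pl_column t s).1 (pl_column t s).2) cM.
  by rewrite summxE mxE => {2}<-; apply: eq_bigr => j _; rewrite !mxE.
move/(congr1 (mulmx^~ (invmx (minor M t)))); rewrite mulmxK // mul0mx.
by move/rowP/(_ i); rewrite !mxE.
Qed.

(** Independence means that the 36 x 3 coordinate matrix has rank 3, so three of its rows form an
    invertible minor. *)
Lemma free_plk (F : fieldType) (M : 'I_3 -> 'M[F]_6) :
  (forall c, \sum_i c i *: M i = 0 -> forall i, c i = 0) -> exists t, plk M t != 0.
Proof.
move=> freeM.
pose A : 'M[F]_(#|{: windex}|, 3) := \matrix_(k, r) M r (enum_val k).1 (enum_val k).2.
have fA : row_full A.
  rewrite /row_full -mxrank_tr; apply/inj_row_free => v vA.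
  apply/rowP => i; rewrite mxE; apply: (freeM (fun i => v 0 i)).
  apply/matrixP => a b; rewrite summxE mxE.
  have := congr1 (fun B : 'rV_ _ => B 0 (enum_rank (a, b))) vA; rewrite !mxE => {2}<-.
  by apply: eq_bigr => j _; rewrite !mxE enum_rankK.
pose f := fullrankfun fA.
exists (enum_val (f 0), enum_val (f 1), enum_val (f 2%:R)).
have e : minor M (enum_val (f 0), enum_val (f 1), enum_val (f 2%:R)) = (rowsub f A)^T.
  apply/matrixP => r s; rewrite !mxE /pl_column.
  case: s => -[|[|[|//]]] lt_s /=.
  - by have -> : Ordinal lt_s = 0 by apply: val_inj.
  - by have -> : Ordinal lt_s = 1 by apply: val_inj.
  - by have -> : Ordinal lt_s = 2%:R by apply: val_inj.
by have := fullrowsub_unit fA; rewrite /plk e det_tr unitmxE unitfE.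
Qed.

End Plucker.

(** * Integral bases of a net *)

Section Normalization.
Variables (F : fieldType) (X : pointedType) (pl : place F X).
Local Notation K := (pl_field pl).
Local Notation R := (pl_ring pl).
Local Notation val := (pl_val pl).

Lemma comb_diag (S : pzRingType) m n (d : 'rV[S]_3) (M : 'I_3 -> 'M[S]_(m, n)) i :
  comb (diag_mx d) M i = d 0 i *: M i.
Proof.
rewrite /comb (bigD1 i) //= big1 => [|j ji]; first by rewrite mxE eqxx mulr1n addr0.
by rewrite mxE eq_sym (negPf ji) scale0r.
Qed.

(** Multiplying by the inverse of a minor of maximal valuation turns all entries into ratios of
    Pluecker coordinates to that minor, which are integral. *)
Lemma integral_basis (M : 'I_3 -> 'M[K]_6) :
  (forall t, integral (plk M t)) -> (exists t, plk M t != 0) ->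
  exists (s : 'M[K]_3) (T : 'I_3 -> 'M[R]_6),
    \det s = 1 /\ forall i, comb s M i = map_mx val (T i).
Proof.
move=> intM /(integral_max (pl := pl))[t w0 ratio]; set w := plk M t in w0 ratio.
(* The factor [w] on the first member restores determinant 1; the entries of that member become
   Pluecker coordinates, integral by hypothesis. *)
pose d : 'rV[K]_3 := \row_i (if i == 0 then w else 1).
pose s := diag_mx d *m invmx (minor M t).
have Nu : minor M t \in unitmx by rewrite unitmxE unitfE.
have sE i : comb (invmx (minor M t)) M i = \matrix_(a, b) (plk M (pl_replace t i (a, b)) / w).
  apply/matrixP => a b; rewrite summxE mxE plk_replace mulr_suml; apply: eq_bigr => k _.
  transitivity (invmx (minor M t) i k * M k a b); first by rewrite mxE.
  have -> : invmx (minor M t) i k = w^-1 * \adj (minor M t) i k.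
    by rewrite /invmx Nu mxE.
  by rewrite -[LHS]mulrA [LHS]mulrC.
have int_s i a b : integral (comb s M i a b).
  rewrite comb_mul comb_diag sE !mxE; case: ifP => _.
    by rewrite mulrCA divff // mulr1.
  have [z ->] := ratio (pl_replace t i (a, b)).
  by exists z; rewrite mul1r mulrAC divff // mul1r.
have [T TE] := choice (fun i => integral_mx (int_s i)).
exists s, T; split=> //; rewrite det_mulmx det_diag det_inv -/(plk M t) -/w.
rewrite big_ord_recl mxE eqxx big1 ?mulr1 ?divff // => j _.
by rewrite mxE.
Qed.
End Normalization.

(** * Properness of the orbit map *)

Section Properness.
Variables (F : fieldType) (X : pointedType) (pl : place F X).
Local Notation K := (pl_field pl).
Local Notation R := (pl_ring pl).
Local Notation cls := (pl_class pl).
Local Notation val := (pl_val pl).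
Local Notation res := (pl_res pl).
Local Notation cst := (pl_cst pl).

(** A ring morphism, so that determinants over the ring of functions are computed pointwise. *)
Definition fct_eval (x : X) (f : X -> F) := f x.
Lemma fct_eval_is_zmod_morphism x : zmod_morphism (fct_eval x). Proof. by []. Qed.
HB.instance Definition _ x := GRing.isZmodMorphism.Build (X -> F) F (fct_eval x)
  (fct_eval_is_zmod_morphism x).
Lemma fct_eval_is_monoid_morphism x : monoid_morphism (fct_eval x). Proof. by []. Qed.
HB.instance Definition _ x := GRing.isMonoidMorphism.Build (X -> F) F (fct_eval x)
  (fct_eval_is_monoid_morphism x).

Definition conj_triple (S : comPzRingType) (g : 'M[S]_6) (M : 'I_3 -> 'M[S]_6) :=
  fun i => g^T *m M i *m g.

Lemma map_conj_triple (S T : comPzRingType) (f : {rmorphism S -> T}) g M i :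
  map_mx f (conj_triple g M i) = conj_triple (map_mx f g) (fun j => map_mx f (M j)) i.
Proof. by rewrite /conj_triple !map_mxM map_trmx. Qed.

Variables (M : 'I_3 -> 'M[F]_6) (G : X -> 'M[F]_6).
Hypothesis G1 : forall x, \det (G x) = 1.
Definition moving : 'M[K]_6 := \matrix_(i, j) cls (fun x => G x i j).
Definition movingF : 'M[X -> F]_6 := \matrix_(i, j) (fun x => G x i j).
Definition fixed : 'I_3 -> 'M[K]_6 := fun i => map_mx val (map_mx cst (M i)).

Lemma movingE : moving = map_mx cls movingF.
Proof. by apply/matrixP => i j; rewrite !mxE. Qed.

Lemma eval_movingF x : map_mx (fct_eval x) movingF = G x.
Proof. by apply/matrixP => i j; rewrite !mxE. Qed.

Lemma det_moving : \det moving = 1.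
Proof.
rewrite movingE det_map_mx -(rmorph1 cls); congr (cls _); apply/funext => x.
by rewrite -[LHS]/(fct_eval x _) -det_map_mx eval_movingF G1.
Qed.

Lemma plk_moving t : plk (conj_triple moving fixed) t = cls (fun x => plk (conj_triple (G x) M) t).
Proof.
pose MF i : 'M[X -> F]_6 := \matrix_(a, b) (fun=> M i a b).
have fixedE i : fixed i = map_mx cls (MF i).
  by apply/matrixP => a b; rewrite !mxE pl_val_cst.
have -> : plk (conj_triple moving fixed) t = cls (plk (conj_triple movingF MF) t).
  rewrite map_plk; apply: plk_ext => i; rewrite map_conj_triple -movingE.
  by rewrite /conj_triple fixedE.
congr (cls _); apply/funext => x; rewrite -[LHS]/(fct_eval x _) map_plk.
apply: plk_ext => i; rewrite map_conj_triple eval_movingF /conj_triple.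
by congr (_ *m _ *m _); apply/matrixP => a b; rewrite !mxE.
Qed.

(** After passing to an integral basis, [integral_of_sextic] makes the change of basis integral.
    Undoing it shows that the conjugated forms are integral, and [integral_of_forms] applies. *)
Lemma moving_integral :
  (forall i, (M i)^T = M i) -> reduced (disc M) -> (exists t, plk M t != 0) ->
  zariski_closed (fun w : vec F _ =>
    exists2 s, \det s = 1 & w = coeffs6 (disc (comb s M))) ->
  (forall s (r : 'I_3 -> int), \det s = 1 -> (exists i, r i != 0) -> \sum_i r i = 0 ->
    (forall m, (disc (comb s M))@_m != 0 -> \sum_i (m i)%:Z * r i = 0) -> False) ->
  (forall t, exists z, val z = cls (fun x => plk (conj_triple (G x) M) t)) ->
  exists g, moving = map_mx val g.
Proof.
move=> symM redM [t0 Mt0] clM finM intM.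
have gu : moving \in unitmx by rewrite unitmxE det_moving unitr1.
have freeK c : \sum_i c i *: conj_triple moving fixed i = 0 -> forall i, c i = 0.
  move=> cM; apply: (@plk_free _ fixed t0).
    rewrite -(map_plk val (fun i => map_mx cst (M i))) -(map_plk cst).
    by rewrite -!(rmorph0 val) (inj_eq (pl_val_inj pl)); apply: contra_neq Mt0 =>
      /(congr1 res); rewrite pl_cstK rmorph0.
  have := congr1 (fun A => (invmx moving)^T *m A *m invmx moving) cM.
  rewrite mulmx0 mul0mx mulmx_sumr mulmx_suml => e; rewrite -[RHS]e.
  apply: eq_bigr => i _.
  rewrite -scalemxAr -scalemxAl /conj_triple; congr (_ *: _).
  by rewrite -!mulmxA mulmxV // mulmx1 mulmxA -trmx_mul mulmxV // trmx1 mul1mx.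
have [|s [T [s1 sT]]] := integral_basis (M := conj_triple moving fixed) _ (free_plk freeK).
  by move=> t; rewrite plk_moving; have [z <-] := intM t; exists z.
have [s' s'E] := integral_of_sextic clM finM s1 det_moving sT.
have s'1 : \det s' = 1.
  by apply: (pl_val_inj pl); rewrite -det_map_mx -s'E s1 rmorph1.
have [_ adjs _] := SL_adj s'1.
apply: (integral_of_forms (B := comb (\adj s') T) symM redM det_moving) => i.
by rewrite map_comb -(comb_ext _ sT) s'E -comb_mul -map_mxM adjs map_mx1 comb1.
Qed.
End Properness.

(** * Stability of the net *)

Section Stability.
Variable F : closedFieldType.

(** Provides the index type of the family of all elements satisfying [P], over which places are
    taken. *)
Lemma pointed_sig (T : Type) (P : T -> Prop) (x0 : T) : P x0 ->
  exists (X : pointedType) (f : X -> T), (forall x, P (f x)) /\ forall y, P y -> exists x, f x = y.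
Proof.
move=> Px0; pose S := {x | P x}.
pose X : pointedType := HB.pack S (gen_eqMixin S) (gen_choiceMixin S)
  (isPointed.Build S (exist _ x0 Px0)).
exists X, (@proj1_sig T P); split; first by case.
by move=> y Py; exists (exist _ y Py).
Qed.

Lemma plucker_act (A1 A2 A3 g : 'M[F]_6) t :
  plucker (act_quad g A1) (act_quad g A2) (act_quad g A3) t =
  plk (conj_triple (invmx g) (triple A1 A2 A3)) t.
Proof.
rewrite pluckerE; apply: plk_ext => i; rewrite /conj_triple /triple.
by case: ifP => // _; case: ifP.
Qed.

Lemma discriminantE (A1 A2 A3 : 'M[F]_6) : discriminant A1 A2 A3 = disc (triple A1 A2 A3).
Proof.
rewrite discE; congr (\det _); apply/matrixP => i j.
rewrite mxE pencil_entry !big_ord_recl big_ord0 addr0 addrA.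
by congr ('X_ _ * _ + 'X_ _ * _ + 'X_ _ * _); apply: val_inj.
Qed.

Lemma quadric_eval0 (A : 'M[F]_6) : (quadric A).@[fun=> 0] = 0.
Proof.
rewrite rmorph_sum big1 // => i _; rewrite rmorph_sum big1 // => j _.
by rewrite /= mevalZ rmorphM /= mevalXU mul0r mulr0.
Qed.

Lemma quadricD (A B : 'M[F]_6) : quadric (A + B) = quadric A + quadric B.
Proof.
rewrite /quadric -big_split; apply: eq_bigr => i _; rewrite -big_split.
by apply: eq_bigr => j _; rewrite mxE scalerDl.
Qed.

Lemma quadricZ c (A : 'M[F]_6) : quadric (c *: A) = c%:MP * quadric A.
Proof.
rewrite /quadric mulr_sumr; apply: eq_bigr => i _; rewrite mulr_sumr.
by apply: eq_bigr => j _; rewrite mxE mul_mpolyC scalerA.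
Qed.

(** By regularity with f = 1, a linear relation would put 1 in the ideal of the preceding quadrics,
    which vanish at the origin. *)
Lemma complete_intersection_free (A1 A2 A3 : 'M[F]_6) :
  complete_intersection (quadric A1) (quadric A2) (quadric A3) ->
  forall c, \sum_i c i *: triple A1 A2 A3 i = 0 -> forall i, c i = 0.
Proof.
move=> [Q1 Q2 Q3] c.
set i0 : 'I_3 := 0; set i1 : 'I_3 := 1; set i2 : 'I_3 := 2%:R.
have -> : \sum_i c i *: triple A1 A2 A3 i = c i0 *: A1 + c i1 *: A2 + c i2 *: A3.
  rewrite !big_ord_recl big_ord0 addr0 addrA.
  by congr (c _ *: _ + c _ *: _ + c _ *: _); apply: val_inj.
have one_nz (p : {mpoly F[6]}) : 1 = p -> p.@[fun=> 0] = 0 -> False.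
  by move=> <- /eqP; rewrite rmorph1 oner_eq0.
move=> e; have c2 : c i2 = 0.
  apply/eqP/negPn/negP => c2.
  have A3E : A3 = (- (c i2)^-1 * c i0) *: A1 + (- (c i2)^-1 * c i1) *: A2.
    apply: (scalerI c2); rewrite scalerDr !scalerA !mulrA mulrN divff // !mulN1r !scaleNr.
    by rewrite -opprD; apply/eqP; rewrite -addr_eq0 addrC e.
  have [|h1 [h2 h]] := Q3 1 (- (c i2)^-1 * c i0)%:MP (- (c i2)^-1 * c i1)%:MP.
    by rewrite mulr1 {1}A3E quadricD !quadricZ.
  by apply: (one_nz _ h); rewrite rmorphD !rmorphM /= !quadric_eval0 !mulr0 addr0.
rewrite c2 scale0r addr0 in e.
have c1 : c i1 = 0.
  apply/eqP/negPn/negP => c1.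
  have A2E : A2 = (- (c i1)^-1 * c i0) *: A1.
    apply: (scalerI c1); rewrite scalerA mulrA mulrN divff // mulN1r scaleNr.
    by apply/eqP; rewrite -addr_eq0 addrC e.
  have [|h1 h] := Q2 1 (- (c i1)^-1 * c i0)%:MP.
    by rewrite mulr1 {1}A2E quadricZ.
  by apply: (one_nz _ h); rewrite rmorphM /= quadric_eval0 mulr0.
rewrite c1 scale0r addr0 in e.
have c0 : c i0 = 0.
  apply/eqP/negPn/negP => c0; case/negP: Q1.
  have -> : A1 = 0 *: A1 by apply: (scalerI c0); rewrite scale0r scaler0.
  by rewrite quadricZ mpolyC0 mul0r.
move=> i; case: i => -[|[|[|//]]] lt_i.
- by rewrite (_ : Ordinal _ = i0) //; apply: val_inj.
- by rewrite (_ : Ordinal _ = i1) //; apply: val_inj.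
- by rewrite (_ : Ordinal _ = i2) //; apply: val_inj.
Qed.

Lemma act_form_disc (g : 'M[F]_3) (M : 'I_3 -> 'M[F]_6) :
  act_form g (disc M) = disc (comb (invmx g)^T M).
Proof. by rewrite act_form_lin disc_comb. Qed.

(** The inverse transpose translates between the action on sextics and the change of basis
    [comb]. *)
Lemma trVmx_invol (n : nat) (g : 'M[F]_n) : \det g = 1 ->
  \det (invmx g)^T = 1 /\ (invmx (invmx g)^T)^T = g.
Proof.
move=> g1; split; first by rewrite det_tr det_inv g1 invr1.
by rewrite -trmx_inv trmxK invmxK.
Qed.

Lemma sextic_stable_closed (M : 'I_3 -> 'M[F]_6) : sextic_stable (disc M) ->
  zariski_closed (fun w : vec F _ => exists2 s, \det s = 1 & w = coeffs6 (disc (comb s M))).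
Proof.
move=> [_ clM _]; congr zariski_closed: clM; apply/funext => w; apply/propext; split.
  move=> [g g1 ->]; exists (invmx g)^T; first by case: (trVmx_invol g1).
  by rewrite act_form_disc.
move=> [s s1 ->]; have [s1' sE] := trVmx_invol s1.
by exists (invmx s)^T; rewrite // act_form_disc sE.
Qed.

Lemma sextic_stable_finite (M : 'I_3 -> 'M[F]_6) : sextic_stable (disc M) -> finite_stabilizer M.
Proof.
move=> [_ _ [l lM]]; exists [seq (invmx g)^T | g <- l] => s s1 sM.
have [s1' sE] := trVmx_invol s1; apply/mapP; exists (invmx s)^T => //.
apply: (lM _ s1').
by rewrite !act_form_disc sE sM invmx1 trmx1 (disc_ext (comb1 _)).
Qed.

Lemma sextic_stable_weights (M : 'I_3 -> 'M[F]_6) : sextic_stable (disc M) ->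
  forall s (r : 'I_3 -> int), \det s = 1 -> (exists i, r i != 0) -> \sum_i r i = 0 ->
    (forall m, (disc (comb s M))@_m != 0 -> \sum_i (m i)%:Z * r i = 0) -> False.
Proof.
move=> /sextic_stable_finite finM s r s1 r0 sr rE.
exact: (no_torus_stabilizer (finite_stabilizer_comb s1 finM) r0 sr rE).
Qed.

Lemma finite_matrices n (S : 'M[F]_n -> Prop) :
  (forall i j, exists l : seq F, forall g, S g -> g i j \in l) ->
  exists l : seq 'M[F]_n, forall g, S g -> g \in l.
Proof.
move=> h; have [l lS] := choice (fun ij : 'I_n * 'I_n => h ij.1 ij.2).
pose L := flatten [seq l ij | ij <- enum {: 'I_n * 'I_n}].
have inL g i j : S g -> g i j \in L.
  move=> Sg; apply/flattenP; exists (l (i, j)); last exact: (lS (i, j)).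
  by apply/mapP; exists (i, j); rewrite ?mem_enum.
exists [seq \matrix_(i, j) nth 0 L (f (i, j)) | f : {ffun 'I_n * 'I_n -> 'I_(size L)}].
move=> g Sg; have idx i j : (index (g i j) L < size L)%N by rewrite index_mem inL.
apply/mapP; exists [ffun ij => Ordinal (idx ij.1 ij.2)]; first by rewrite mem_enum.
by apply/matrixP => i j; rewrite !mxE ffunE nth_index // inL.
Qed.

Lemma polyfun1_poly (P : vec F unit -> F) : polyfun P ->
  exists p : {poly F}, forall v, P v = p.[v tt].
Proof.
elim=> [c|[]|f g _ [p pE] _ [q qE]|f g _ [p pE] _ [q qE]].
- by exists c%:P => v; rewrite hornerC.
- by exists 'X => v; rewrite hornerX.
- by exists (p + q) => v; rewrite hornerD pE qE.
- by exists (p * q) => v; rewrite hornerM pE qE.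
Qed.

Section Net.
Variable M : 'I_3 -> 'M[F]_6.
Hypotheses (symM : forall i, (M i)^T = M i) (redM : reduced (disc M)).
Hypotheses (stM : sextic_stable (disc M)) (plM : exists t, plk M t != 0).

(** In a place centred at [v], the generic element of SL6 is integral by [moving_integral]; its
    reduction carries the net to [v]. *)
Lemma net_orbit_closed (v : vec F pl_index) :
  (forall P : vec F pl_index -> F, polyfun P ->
    (forall g, \det g = 1 -> P [ffun t => plk (conj_triple g M) t] = 0) -> P v = 0) ->
  exists2 g, \det g = 1 & forall t, v t = plk (conj_triple g M) t.
Proof.
move=> adh; have [X [G [G1 GE]]] := @pointed_sig _ (fun g : 'M[F]_6 => \det g = 1) 1%:M (det1 _ _).
have [|pl plE] := @adherent_place F X pl_index
    (fun x => [ffun t => plk (conj_triple (G x) M) t]) v.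
  by move=> P PP P0; apply: adh => // g /GE[x <-]; exact: P0.
have clsE t : pl_class pl (fun x => [ffun t => plk (conj_triple (G x) M) t] t) =
    pl_class pl (fun x => plk (conj_triple (G x) M) t).
  by congr (pl_class pl _); apply/funext => x; rewrite ffunE.
have [|g gE] := @moving_integral _ _ pl _ _ G1 symM redM plM (sextic_stable_closed stM)
    (sextic_stable_weights stM).
  by move=> t; have [z zE _] := plE t; exists z; rewrite zE clsE.
have g1 : \det g = 1.
  by apply: (pl_val_inj pl); rewrite -det_map_mx -gE det_moving // rmorph1.
exists (map_mx (pl_res pl) g); first by rewrite det_map_mx g1 rmorph1.
move=> t; have [z zE <-] := plE t.
have -> : z = plk (conj_triple g (fun i => map_mx (pl_cst pl) (M i))) t.
  apply: (pl_val_inj pl); rewrite zE clsE -plk_moving // map_plk; apply: plk_ext => i.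
  by rewrite map_conj_triple gE.
rewrite map_plk; apply: plk_ext => i; rewrite map_conj_triple /conj_triple.
by rewrite map_res_cst.
Qed.

(** If the entry took infinitely many values, some place would send its inverse to 0, whereas the
    entry is integral by [moving_integral]. *)
Lemma net_stabilizer_entries i j : exists l : seq F, forall g : 'M[F]_6, \det g = 1 ->
  (forall t, plk (conj_triple g M) t = plk M t) -> g i j \in l.
Proof.
pose S (g : 'M[F]_6) := [/\ \det g = 1, forall t, plk (conj_triple g M) t = plk M t & g i j != 0].
have [[l lS]|infS] := EM (exists l : seq F, forall g, S g -> g i j \in l).
  exists (0 :: l) => g g1 gM; rewrite inE; have [//|gij /=] := eqVneq (g i j) 0.
  exact: lS.
have [g0 Sg0] : exists g0, S g0.
  by apply: contrapT => nS; case: infS; exists [::] => g Sg; case: nS; exists g.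
exfalso; have [X [G [GS GE]]] := pointed_sig Sg0.
(* The inverses form an infinite subset of the affine line, so 0 is in their closure: a nonzero
   polynomial has finitely many roots. *)
have [|pl plE] := @adherent_place F X unit (fun x => [ffun=> (G x i j)^-1]) [ffun=> 0].
  move=> P /polyfun1_poly[p pE] P0.
  suff -> : P = fun=> 0 by [].
  apply/funext => w; rewrite pE; suff -> : p = 0 by rewrite horner0.
  apply/eqP/negPn/negP => p0; case: infS.
  have [rs rsE] := closed_field_poly_normal p.
  exists [seq a^-1 | a <- rs] => g Sg; apply/mapP; exists (g i j)^-1; last by rewrite invrK.
  have [x xg] := GE g Sg; have := P0 x; rewrite pE ffunE xg rsE hornerZ => /eqP.
  by rewrite mulf_eq0 lead_coef_eq0 (negPf p0) -rootE root_prod_XsubC.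
have G1 x : \det (G x) = 1 by case: (GS x).
have [|g gE] := @moving_integral _ _ pl _ _ G1 symM redM plM (sextic_stable_closed stM)
    (sextic_stable_weights stM).
  move=> t; exists (pl_cst pl (plk M t)); rewrite pl_val_cst; congr (pl_class pl _).
  by apply/funext => x; case: (GS x).
have [z zE z0] := plE tt; rewrite ffunE in z0.
have e : z * g i j = 1.
  apply: (pl_val_inj pl); rewrite rmorphM rmorph1 zE.
  have -> : pl_val pl (g i j) = pl_class pl (fun x => G x i j).
    by have := congr1 (fun A : 'M_6 => A i j) gE; rewrite !mxE.
  rewrite -rmorphM -(rmorph1 (pl_class pl)); congr (pl_class pl _); apply/funext => x.
  by rewrite mulrfctE ffunE mulVf //; case: (GS x).
by have /eqP := congr1 (pl_res pl) e; rewrite rmorphM rmorph1 /= z0 mul0r eq_sym oner_eq0.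
Qed.

Lemma net_stabilizer_finite : exists l : seq 'M[F]_6, forall g, \det g = 1 ->
  (forall t, plk (conj_triple g M) t = plk M t) -> g \in l.
Proof.
have [|l lP] := @finite_matrices 6 (fun g => \det g = 1 /\
    forall t, plk (conj_triple g M) t = plk M t).
  by move=> i j; have [l lP] := net_stabilizer_entries i j; exists l => g [g1 gM]; exact: lP.
by exists l => g g1 gM; exact: lP.
Qed.
End Net.
End Stability.

Theorem theorem3p2 (A1 A2 A3 : 'M[CC]_6) :
  A1^T = A1 -> A2^T = A2 -> A3^T = A3 ->
  complete_intersection (quadric A1) (quadric A2) (quadric A3) ->
  reduced (discriminant A1 A2 A3) ->
  sextic_stable (discriminant A1 A2 A3) ->
  net_stable A1 A2 A3.
Proof.
move=> s1 s2 s3 /complete_intersection_free/free_plk plM.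
rewrite discriminantE => redM stM; set M := triple A1 A2 A3 in plM redM stM.
have symM i : (M i)^T = M i by rewrite /M /triple; do 2?case: ifP => _.
have orbE g t : plucker (act_quad g A1) (act_quad g A2) (act_quad g A3) t =
  plk (conj_triple (invmx g) M) t by exact: plucker_act.
have M1 t : plk (conj_triple (invmx 1%:M) M) t = plk M t.
  by apply: plk_ext => i; rewrite /conj_triple invmx1 trmx1 mul1mx mulmx1.
split.
- have [t Mt] := plM; apply: contraNneq Mt => /(congr1 (fun v : vec _ _ => v t)).
  by rewrite orbE M1 ffunE => ->.
(* If no polynomial separates [v] from the orbit, [v] is adherent to it, hence lies in it. *)
- move=> v nv; apply: contrapT => nP; apply: nv.
  have [P PP P0|g g1 vE] := net_orbit_closed symM redM stM plM (v := v).
    apply: contrapT => Pv; apply: nP; exists P; split=> // w [g g1 ->].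
    have [g1' _] := trVmx_invol g1; rewrite det_tr in g1'.
    rewrite -[RHS](P0 _ g1'); congr P; apply/ffunP => t.
    by rewrite orbE [RHS]ffunE.
  (* [act_quad] acts through the inverse matrix. *)
  exists (invmx g); first by rewrite /SL det_inv g1 invr1.
  by apply/ffunP => t; rewrite vE orbE invmxK.
- have [l lP] := net_stabilizer_finite symM redM stM plM.
  exists [seq invmx g | g <- l] => g g1 gM; apply/mapP; exists (invmx g); last by rewrite invmxK.
  have [g1' _] := trVmx_invol g1; rewrite det_tr in g1'.
  apply: (lP _ g1') => t.
  apply: etrans (esym (orbE g t)) (etrans _ (etrans (orbE 1%:M t) (M1 t))).
  by rewrite gM.
Qed.
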